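(* There exists a universal constant $t<1$ (with $t>0$) such that for communication cost $c\le ndt$ (with $c>0$) and $n\ge 1/t$, $$\mathcal{E}(\Pi(c),S^d)=\Theta\left(\min\left(1,\frac dc\right)\right),$$ where the constants implied by $\Theta$ are universal, and $\mathcal{E}(\Pi(c),S^d)$ is the minimax mean squared error, over independent protocols with $n$ clients and communication cost at most $c$ bits, of estimating the mean of $n$ vectors in the unit ball of $\mathbb{R}^d$.
   Context: Distributed mean estimation: $n$ clients hold vectors $X^n=(X_1,\dots,X_n)$, $X_i\in\mathbb{R}^d$, with mean $\bar X=\frac1n\sum_{i=1}^n X_i$. No distributional assumption is made on the data. $S^d=\{x\in\mathbb{R}^d:\|x\|_2\le 1\}$ is the unit ball. An independent (simultaneous) protocol $\pi$: the clients independently send data to a server; client $i$ transmits a function $f(X_i)$ of its vector, and the server estimates the mean by some function of $f(X_1),\dots,f(X_n)$, the estimate being denoted $\hat{\bar X}$. Both private randomness (random values generated by each machine separately) and public randomness (a sequence of random values shared among all parties) may be used. $\mathcal{C}_i(\pi,X_i)$ is the expected number of bits transmitted by client $i$, and $\mathcal{C}(\pi,X^n)=\sum_{i=1}^n\mathcal{C}_i(\pi,X_i)$; expectations are over the randomness in the protocol. $\mathcal{E}(\pi,X^n)=\mathbb{E}\|\hat{\bar X}-\bar X\|_2^2$. The worst-case error is $\mathcal{E}(\pi,S^d)=\max\{\mathcal{E}(\pi,X^n): X_i\in S^d\ \forall i\}$. $\Pi(c)$ is the set of all independent protocols with communication cost at most $c$, i.e. $\mathcal{C}(\pi,X^n)\le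 c$ for all $X^n$ with all $X_i\in S^d$. The minimax error is $\mathcal{E}(\Pi(c),S^d)=\min_{\pi\in\Pi(c)}\mathcal{E}(\pi,S^d)$ (max and min are to be read as sup and inf).
   Formalization: Protocols are required to be self-delimiting: given the public randomness, the bit strings a client may transmit form a prefix-free set (silence is free only if publicly prescribed); with free data-dependent silence the lower bound fails for c = d and n much larger than d. *)

(* Defs.v *)
From mathcomp Require Import all_boot all_order all_algebra.
From mathcomp Require Import all_classical all_reals all_analysis.

Set Implicit Arguments.
Unset Strict Implicit.
Unset Printing Implicit Defensive.

Import Order.TTheory GRing.Theory Num.Theory.

Local Open Scope classical_set_scope.
Local Open Scope ring_scope.

(* The library norm `|x| on row vectors is the sup norm, hence this one. *)
Definition norm2 (R : realType) (d : nat) (x : 'rV[R]_d) : R :=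
  Num.sqrt (\sum_(j < d) x ord0 j ^+ 2).

Definition unit_ball (R : realType) (d : nat) : set 'rV[R]_d :=
  [set x | norm2 x <= 1].

Definition mean (R : realType) (d n : nat) (X : 'I_n -> 'rV[R]_d) : 'rV[R]_d :=
  n%:R^-1 *: \sum_(i < n) X i.

(* Independent (simultaneous) protocols for n clients holding vectors of R^d.

   Randomness: the public seed u has law pub_law; client i draws the private
   seed tnth r i, where r has law priv_law.  By priv_indep, priv_law is the
   product of its marginals (which may differ from client to client).  The
   public seed is independent of r: (u, r) has law pub_law \x priv_law.
   Private coins of the server can be put in u and ignored by the clients.

   Messages are finite bit strings, possibly empty.  They are self-delimiting:
   once the public seed is fixed, the strings that a given client may send form
   a prefix-free set.  So a client may be silent, at cost 0, exactly when the
   public seed prescribes it (client sampling); without this condition the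
   choice between silence and speech would carry information for free.

   The vectors are arbitrary, so no measurability in x is required. *)
Record protocol (R : realType) (d n : nat) : Type := Protocol {
  pub_display : measure_display ;
  pub : measurableType pub_display ;
  pub_law : probability pub R ;
  priv_display : measure_display ;
  priv : measurableType priv_display ;
  priv_law : probability (n.-tuple priv) R ;
  priv_indep : forall A : 'I_n -> set priv, (forall i, measurable (A i)) ->
    fine (priv_law [set r | forall i, A i (tnth r i)]) =
    \prod_(i < n) fine (priv_law [set r | A i (tnth r i)]) ;
  encode : 'I_n -> pub -> priv -> 'rV[R]_d -> seq bool ;
  encode_measurable : forall i x m,
    measurable [set w : pub * priv | encode i w.1 w.2 x = m] ;
  encode_prefix_free : forall i u r r' x x',
    prefix (encode i u r x) (encode i u r' x') ->
    encode i u r x = encode i u r' x' ;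
  decode : pub -> n.-tuple (seq bool) -> 'rV[R]_d ;
  decode_measurable : forall m j,
    measurable_fun setT (fun u => decode u m ord0 j)
}.

Section Protocol.
Variables (R : realType) (d n : nat).
Implicit Types (pi : protocol R d n) (X : 'I_n -> 'rV[R]_d).

Definition message pi X (i : 'I_n) (w : pub pi * n.-tuple (priv pi)) : seq bool :=
  encode i w.1 (tnth w.2 i) (X i).

Definition estimate pi X (w : pub pi * n.-tuple (priv pi)) : 'rV[R]_d :=
  decode w.1 [tuple message X i w | i < n].

Definition client_cost pi X (i : 'I_n) : \bar R :=
  (\int[pub_law pi \x priv_law pi]_w (size (message X i w))%:R%:E)%E.

Definition cost pi X : \bar R := (\sum_(i < n) client_cost pi X i)%E.

Definition mse pi X : \bar R :=
  (\int[pub_law pi \x priv_law pi]_w (norm2 (estimate X w - mean X) ^+ 2)%:E)%E.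

Definition ball_data : set ('I_n -> 'rV[R]_d) :=
  [set X | forall i, unit_ball (X i)].

Definition worst_error pi : \bar R := ereal_sup [set mse pi X | X in ball_data].

Definition cost_at_most (c : R) pi : Prop :=
  forall X, ball_data X -> (cost pi X <= c%:E)%E.

(* The image of a [set (protocol R d n)] is not available for universe reasons. *)
Definition minimax_error (c : R) : \bar R :=
  ereal_inf [set e | exists2 pi, cost_at_most c pi & worst_error pi = e].

End Protocol.

(* Main.v *)
From HB Require Import structures.
Require Import Defs.
From mathcomp Require Import all_boot all_order all_algebra.
From mathcomp Require Import all_classical all_reals all_analysis.
From mathcomp Require Import measurable_realfun ring lra.

Set Implicit Arguments.
Unset Strict Implicit.
Unset Printing Implicit Defensive.

Import Order.TTheory GRing.Theory Num.Theory.

Local Open Scope classical_set_scope.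
Local Open Scope ring_scope.

(* Upper bound: scaled by sqrt d, a vector of the ball has l1 norm at most d, so
   randomized rounding to Z^d followed by unary coding costs at most 4 d bits and
   has error O(1).  If each client speaks with probability p = c / (4 d n), the
   cost is at most c and the error O(1 / (n p)) = O(d / c).

   Lower bound: draw t uniformly in the cube {-1, 1}^d and, given t, the points
   sqrt(d) X_i independently in the cube with mean delta t.  For fixed seeds a
   client is a prefix-free code of the cube.  By the level-one inequality (a
   sub-Gaussian bound on the mean of the scores over a cell of the code) and
   Kraft's inequality, the chi-square distances between the message laws for t
   and for t with one bit flipped add up, over the d bits, to at most
   64 delta^2 E[length].  Along the n clients the chi-square distances
   tensorize, and a two-point bound for each bit leaves an error of at least
   delta^2 / 2 - 1 / n - 64 delta^4 c / d; then take delta^2 of order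
   min(1, d / c). *)

(** * Product laws and the two-point bound *)

(** Inverting [1 - y <= expR (- y)] reduces the claim to [0 <= y ^+ 2 * (1 - 2 * y)]. *)
Lemma expR_le1DxM2 (R : realType) (y : R) :
  y <= 2^-1 -> expR y <= 1 + y + 2 * y ^+ 2.
Proof.
move=> y2; have y1 : 0 < 1 - y by lra.
have h : expR y <= (1 - y)^-1.
  rewrite -[expR y]invrK lef_pV2 ?posrE ?invr_gt0 ?expR_gt0 // -expRN.
  exact: expR_ge1Dx.
apply: le_trans h _; rewrite -[leLHS]mul1r ler_pdivrMr //.
rewrite -subr_ge0 (_ : _ - _ = y ^+ 2 * (1 - 2 * y)); last by ring.
by apply: mulr_ge0; [exact: sqr_ge0|lra].
Qed.

(* The minimum over [h] of the right-hand side is [(a - b)^2 A / (1 + A)]; the left-hand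
   side is a minorant that is polynomial in the likelihood ratio [A], hence
   computable on product laws. *)
Lemma two_point_quadratic (R : realFieldType) (A a b h : R) : 0 <= A ->
  (a - b) ^+ 2 / 4 * (3 * A - A ^+ 2) <= (h - a) ^+ 2 + A * (h - b) ^+ 2.
Proof.
move=> A0; have A1 : 0 < 1 + A by lra.
rewrite -subr_ge0 -(pmulr_rge0 _ A1).
have -> : (1 + A) * ((h - a) ^+ 2 + A * (h - b) ^+ 2 -
      (a - b) ^+ 2 / 4 * (3 * A - A ^+ 2)) =
    ((h - a) + A * (h - b)) ^+ 2 + (a - b) ^+ 2 / 4 * (A * (1 - A) ^+ 2).
  by field.
by apply: addr_ge0 (sqr_ge0 _) _; apply: mulr_ge0;
  rewrite ?divr_ge0 ?sqr_ge0 // mulr_ge0 ?sqr_ge0.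
Qed.

Section Product.
Variables (R : realType) (I K : finType).
Implicit Types (w : I -> K -> R).

Lemma sum_prod_ffun (F : I -> K -> R) :
  \sum_(f : {ffun I -> K}) \prod_i F i (f i) = \prod_i \sum_k F i k.
Proof. by rewrite bigA_distr_bigA. Qed.

Lemma sum_prod_ffun1 w (i : I) (h : K -> R) :
  (forall j, \sum_k w j k = 1) ->
  \sum_(f : {ffun I -> K}) \prod_j w j (f j) * h (f i) = \sum_k w i k * h k.
Proof.
move=> w1; pose F j k := w j k * (if j == i then h k else 1).
transitivity (\sum_(f : {ffun I -> K}) \prod_j F j (f j)).
  apply: eq_bigr => f _; rewrite /F big_split /=; congr (_ * _).
  by rewrite -big_mkcond big_pred1_eq.
rewrite sum_prod_ffun (bigD1 i) //= [X in _ * X]big1 ?mulr1 => [|j ji].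
  by rewrite /F eqxx.
by rewrite /F (negPf ji); under eq_bigr do rewrite mulr1; rewrite w1.
Qed.

Lemma sum_prod_ffun2 w (i i' : I) (h h' : K -> R) : i != i' ->
  (forall j, \sum_k w j k = 1) ->
  \sum_(f : {ffun I -> K}) \prod_j w j (f j) * (h (f i) * h' (f i')) =
  (\sum_k w i k * h k) * (\sum_k w i' k * h' k).
Proof.
move=> ii' w1.
pose F j k := w j k * ((if j == i then h k else 1) * (if j == i' then h' k else 1)).
transitivity (\sum_(f : {ffun I -> K}) \prod_j F j (f j)).
  apply: eq_bigr => f _; rewrite /F !big_split /=; congr (_ * (_ * _)).
    by rewrite -big_mkcond big_pred1_eq.
  by rewrite -big_mkcond big_pred1_eq.
rewrite sum_prod_ffun (bigD1 i) //= (bigD1 i') 1?eq_sym //= mulrA.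
rewrite [X in _ * X]big1 ?mulr1 => [|j /andP[ji ji']].
  rewrite /F eqxx (negPf ii') eq_sym (negPf ii') eqxx.
  by congr (_ * _); apply: eq_bigr => k _; rewrite ?mulr1 ?mul1r.
by rewrite /F (negPf ji) (negPf ji'); under eq_bigr do rewrite !mulr1; rewrite w1.
Qed.

(** The coordinates are independent, so the second moment about [a] is the sum of the variances plus
    the squared bias; each variance is then bounded by the raw second moment. *)
Lemma sum_prod_sqr_le w (F : I -> K -> R) (a : R) :
  (forall i k, 0 <= w i k) -> (forall i, \sum_k w i k = 1) ->
  \sum_(f : {ffun I -> K}) \prod_i w i (f i) * (\sum_i F i (f i) - a) ^+ 2 <=
  \sum_i \sum_k w i k * F i k ^+ 2 + (\sum_i \sum_k w i k * F i k - a) ^+ 2.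
Proof.
move=> w0 w1; pose e i := \sum_k w i k * F i k; pose G i k := F i k - e i.
have EG i : \sum_k w i k * G i k = 0.
  rewrite /G; under eq_bigr do rewrite mulrBr.
  by rewrite sumrB -mulr_suml w1 mul1r subrr.
set c := \sum_i e i - a; rewrite -/c.
have W1 : \sum_(f : {ffun I -> K}) \prod_j w j (f j) = 1.
  by rewrite sum_prod_ffun big1.
have -> : \sum_(f : {ffun I -> K}) \prod_i w i (f i) * (\sum_i F i (f i) - a) ^+ 2 =
    \sum_i \sum_k w i k * G i k ^+ 2 + c ^+ 2.
  (* Expand the square around the means: pairs of distinct coordinates contribute zero, as does each
     term linear in the centred [G]. *)
  transitivity (\sum_(f : {ffun I -> K})
    (\sum_i \sum_i' \prod_j w j (f j) * (G i (f i) * G i' (f i'))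
     + \sum_i 2 * c * (\prod_j w j (f j) * G i (f i)) + c ^+ 2 * \prod_j w j (f j))).
    apply: eq_bigr => f _; set P := \prod_j _.
    have -> : \sum_i F i (f i) - a = \sum_i G i (f i) + c.
      by rewrite /c /G sumrB; ring.
    have -> : \sum_i 2 * c * (P * G i (f i)) = 2 * c * (P * \sum_i G i (f i)).
      by rewrite !mulr_sumr.
    have -> : \sum_i \sum_i' P * (G i (f i) * G i' (f i')) =
        P * (\sum_i G i (f i)) ^+ 2.
      rewrite expr2 mulr_suml mulr_sumr; apply: eq_bigr => i _.
      by rewrite !mulr_sumr.
    ring.
  rewrite !big_split /= -mulr_sumr W1 mulr1 [X in _ + X + _]exchange_big /=.
  rewrite [X in _ + X + _]big1 ?addr0 => [|i _]; last first.
    by rewrite -mulr_sumr sum_prod_ffun1 // EG mulr0.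
  congr (_ + _); rewrite exchange_big /=; apply: eq_bigr => i _.
  rewrite exchange_big /= (bigD1 i) //= [X in _ + X]big1 ?addr0 => [|i' ii'].
    rewrite (sum_prod_ffun1 i (fun k => G i k * G i k)) //.
  by rewrite sum_prod_ffun2 1?eq_sym // !EG mulr0.
rewrite lerD2r; apply: ler_sum => i _.
have -> : \sum_k w i k * G i k ^+ 2 = \sum_k w i k * F i k ^+ 2 - e i ^+ 2.
  transitivity (\sum_k (w i k * F i k ^+ 2 - 2 * e i * (w i k * F i k) + e i ^+ 2 * w i k)).
    by apply: eq_bigr => k _; rewrite /G; ring.
  by rewrite !big_split /= sumrN -!mulr_sumr w1 -/(e i); ring.
by rewrite gerBl sqr_ge0.
Qed.

Lemma prod1D_le_expR (x : I -> R) : (forall i, 0 <= x i) ->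
  \prod_i (1 + x i) <= expR (\sum_i x i).
Proof.
move=> x0; rewrite expR_sum; apply: ler_prod => i _.
by rewrite expR_ge1Dx andbT addr_ge0.
Qed.

(** A form of Le Cam's method: [Q] and [Q * L] are the message laws under two parameters with target
    values [a] and [b], and [chi i] is the chi-square distance for client [i]. Under the product law
    the squared likelihood ratio has mean [\prod_i (1 + chi i)]. *)
Lemma two_point (Q L : I -> K -> R) (chi : I -> R)
    (h : {ffun I -> K} -> R) (a b : R) :
  (forall i m, 0 <= Q i m) -> (forall i m, 0 <= L i m) ->
  (forall i, \sum_m Q i m * L i m = 1) ->
  (forall i, \sum_m Q i m * L i m ^+ 2 = 1 + chi i) -> (forall i, 0 <= chi i) ->
  (a - b) ^+ 2 * (1 - 2 * \sum_i chi i) / 2 <=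
  \sum_(M : {ffun I -> K}) \prod_i Q i (M i) * (h M - a) ^+ 2 +
  \sum_(M : {ffun I -> K}) \prod_i (Q i (M i) * L i (M i)) * (h M - b) ^+ 2.
Proof.
move=> Q0 L0 QL1 QL2 chi0; set s := \sum_i chi i.
have s0 : 0 <= s by apply: sumr_ge0.
(* For [s >= 1/2] the left-hand side is nonpositive. *)
have [s2|s2] := leP 2^-1 s.
  apply: (@le_trans _ _ 0).
    rewrite pmulr_lle0 ?invr_gt0 //; apply: mulr_ge0_le0; first exact: sqr_ge0.
    by lra.
  apply: addr_ge0; apply: sumr_ge0 => M _; apply: mulr_ge0 (sqr_ge0 _);
    by apply: prodr_ge0 => i _; rewrite ?mulr_ge0.
rewrite -big_split /=.
(* The quadratic minorant averages to a multiple of [3 - \prod_i (1 + chi i) >= 2 - 2 * s], where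
   [2 - 4 * s] would do. *)
apply: (@le_trans _ _ (\sum_(M : {ffun I -> K}) (a - b) ^+ 2 / 4 *
   (3 * \prod_i (Q i (M i) * L i (M i)) - \prod_i (Q i (M i) * L i (M i) ^+ 2)))).
  rewrite -mulr_sumr sumrB -mulr_sumr.
  rewrite (sum_prod_ffun (fun i m => Q i m * L i m)).
  rewrite (sum_prod_ffun (fun i m => Q i m * L i m ^+ 2)).
  rewrite (eq_bigr _ (fun i _ => QL1 i)) (eq_bigr _ (fun i _ => QL2 i)) big1 //.
  have h1 : \prod_i (1 + chi i) <= 1 + 2 * s.
    apply: le_trans (prod1D_le_expR chi0) _; rewrite -/s.
    apply: (le_trans (expR_le1DxM2 (ltW s2))); rewrite -subr_ge0.
    rewrite (_ : _ - _ = s * (1 - 2 * s)); last by ring.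
    by apply: mulr_ge0 => //; lra.
  rewrite -mulrA -mulrA; apply: ler_wpM2l; first exact: sqr_ge0.
  lra.
apply: ler_sum => M _.
pose W := \prod_i Q i (M i); pose A := \prod_i L i (M i).
rewrite (_ : \prod_i (_ * L _ _) = W * A); last by rewrite -big_split.
rewrite (_ : \prod_i (_ * L _ _ ^+ 2) = W * A ^+ 2); last first.
  by rewrite -prodrXl -big_split.
rewrite -/W.
have W0 : 0 <= W by apply: prodr_ge0.
have A0 : 0 <= A by apply: prodr_ge0.
rewrite -subr_ge0 (_ : _ - _ = W * ((h M - a) ^+ 2 + A * (h M - b) ^+ 2 -
   (a - b) ^+ 2 / 4 * (3 * A - A ^+ 2))); last by ring.
by apply: mulr_ge0 => //; rewrite subr_ge0 two_point_quadratic.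
Qed.

End Product.

(** * The level-one inequality *)

Section LevelOne.
Variables (R : realType) (I K Msg : finType) (w g : I -> K -> R).
Hypothesis w_ge0 : forall i k, 0 <= w i k.
Hypothesis w_sum1 : forall i, \sum_k w i k = 1.
Hypothesis g_mean0 : forall i, \sum_k w i k * g i k = 0.
Hypothesis g_var : forall i, \sum_k w i k * g i k ^+ 2 <= 2.
Hypothesis g_bounded : forall i k, `|g i k| <= 2.

Let W (x : {ffun I -> K}) : R := \prod_i w i (x i).

Let W_ge0 x : 0 <= W x. Proof. exact: prodr_ge0. Qed.

(** A sub-Gaussian bound for one coordinate: [|y * g i k| <= 1/2] allows the quadratic bound on
    [expR], and mean zero with second moment at most 2 leaves
    [1 + 4 * y ^+ 2 <= expR (4 * y ^+ 2)]. *)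
Lemma mgf_le1 i (y : R) : `|y| <= 4^-1 ->
  \sum_k w i k * expR (y * g i k - 4 * y ^+ 2) <= 1.
Proof.
move=> y4; under eq_bigr do rewrite expRD mulrA.
rewrite -mulr_suml expRN ler_pdivrMr ?expR_gt0 // mul1r.
apply: le_trans (expR_ge1Dx _).
apply: (@le_trans _ _ (\sum_k (w i k + y * (w i k * g i k) +
   2 * y ^+ 2 * (w i k * g i k ^+ 2)))).
  apply: ler_sum => k _; rewrite (_ : _ + _ =
     w i k * (1 + y * g i k + 2 * (y * g i k) ^+ 2)); last by ring.
  apply: ler_wpM2l => //; apply: expR_le1DxM2.
  apply: le_trans (ler_norm _) _; rewrite normrM.
  apply: le_trans (ler_pM _ _ y4 (g_bounded i k)) _ => //; lra.
rewrite !big_split /= -!mulr_sumr w_sum1 g_mean0 mulr0 addr0 lerD2l.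
have := ler_wpM2l (mulr_ge0 (ler0n R 2) (sqr_ge0 y)) (g_var i).
by move/le_trans; apply; lra.
Qed.

(* [1 + z <= expR z] is applied to [z = <v, g> / 8 - |v|^2 / 16 - l], where [v] is the
   mean of [g] over [A]. *)
Lemma level_one (A : pred {ffun I -> K}) (l : R) :
  let q := \sum_(x | A x) W x in
  q * (1 + (\sum_i ((\sum_(x | A x) W x * g i (x i)) / q) ^+ 2) / 16 - l)
  <= expR (- l).
Proof.
move=> /=; set q := \sum_(x | A x) W x.
set v := fun i => (\sum_(x | A x) W x * g i (x i)) / q.
rewrite -/(\sum_i v i ^+ 2).
have q0 : 0 <= q by exact: sumr_ge0.
have [->|qn0] := eqVneq q 0; first by rewrite mul0r expR_ge0.
have qv i : \sum_(x | A x) W x * g i (x i) = q * v i.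
  by rewrite /v mulrCA divff ?mulr1.
(* This puts [v i / 8] in the range allowed by [mgf_le1]. *)
have v2 i : `|v i| <= 2.
  rewrite -(ler_pM2l (_ : 0 < q)) ?lt_def ?qn0 // -{1}(ger0_norm q0) -normrM -qv.
  apply: le_trans (ler_norm_sum _ _ _) _; rewrite mulr_suml.
  apply: ler_sum => x _; rewrite normrM (ger0_norm (W_ge0 x)).
  exact: ler_wpM2l.
(* The choice [y = v i / 8] maximizes [y * v i - 4 * y ^+ 2], with value [v i ^+ 2 / 16]. *)
pose E x := \sum_i (v i / 8 * g i (x i) - 4 * (v i / 8) ^+ 2).
have -> : q * (1 + (\sum_i v i ^+ 2) / 16 - l) =
    \sum_(x | A x) W x * (1 + (E x - l)).
  transitivity (\sum_(x | A x) (W x * (1 - l) + \sum_i (v i / 8 * (W x * g i (x i))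
      - 4 * (v i / 8) ^+ 2 * W x))).
    rewrite big_split /= -mulr_suml exchange_big /= -/q.
    under [X in _ = _ + X]eq_bigr do rewrite sumrB -!mulr_sumr qv -/q.
    rewrite [X in _ = _ + X](_ : _ = q * ((\sum_i v i ^+ 2) / 16)); first by ring.
    rewrite mulrA (mulr_sumr _ _ _ q) mulr_suml.
    by apply: eq_bigr => i _; field.
  apply: eq_bigr => x _; rewrite [X in _ + X](_ : _ = W x * E x); first by ring.
  by rewrite /E mulr_sumr; apply: eq_bigr => i _; ring.
apply: (@le_trans _ _ (\sum_(x | A x) W x * expR (E x - l))).
  by apply: ler_sum => x _; apply: ler_wpM2l => //; exact: expR_ge1Dx.
(* The terms are nonnegative, so the sum may run over all [x], where the product law makes it factor
   over the coordinates. *)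
apply: (@le_trans _ _ (\sum_x W x * expR (E x - l))).
  rewrite [leRHS](bigID A) /= lerDl; apply: sumr_ge0 => x _.
  by rewrite mulr_ge0 ?expR_ge0.
under eq_bigr do rewrite expRD mulrA.
rewrite -mulr_suml ler_piMl ?expR_ge0 //.
under eq_bigr do rewrite expR_sum -big_split /=.
rewrite (sum_prod_ffun (fun i k => w i k * expR (v i / 8 * g i k - 4 * (v i / 8) ^+ 2))).
apply: (@le_trans _ _ (\prod_(i : I) (1 : R))); last by rewrite big1.
apply: ler_prod => i _; apply/andP; split.
  by apply: sumr_ge0 => k _; rewrite mulr_ge0 ?expR_ge0.
by apply: mgf_le1; rewrite normrM (@ger0_norm _ 8^-1) //; have := v2 i; lra.
Qed.

(** Sum [level_one] over the cells of [f] with [l = len m]: by Kraft's inequality the right-hand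
    sides add up to at most 1, which cancels the total mass 1 on the left. *)
Lemma level_one_code (f : {ffun I -> K} -> Msg) (len : Msg -> R) :
  \sum_(m | m \in codom f) expR (- len m) <= 1 ->
  \sum_m (\sum_(x | f x == m) W x) *
     (\sum_i ((\sum_(x | f x == m) W x * g i (x i)) /
              (\sum_(x | f x == m) W x)) ^+ 2)
  <= 16 * \sum_x W x * len (f x).
Proof.
move=> kraft; pose q m := \sum_(x | f x == m) W x.
pose V m := \sum_i ((\sum_(x | f x == m) W x * g i (x i)) / q m) ^+ 2.
rewrite -[leLHS]/(\sum_m q m * V m).
have W1 : \sum_x W x = 1 by rewrite sum_prod_ffun big1.
have sumf (F : Msg -> R) : \sum_x W x * F (f x) = \sum_(m | m \in codom f) q m * F m.
  rewrite (partition_big f (mem (codom f))) /=; last by move=> x _; exact: codom_f.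
  by apply: eq_bigr => m _; rewrite mulr_suml; apply: eq_bigr => x /eqP ->.
have : \sum_(m | m \in codom f) q m * (1 + V m / 16 - len m) <= 1.
  apply: le_trans kraft; apply: ler_sum => m _.
  exact: (level_one (fun x => f x == m)).
under eq_bigr do rewrite -addrA mulrDr mulr1 mulrBr.
rewrite big_split /= sumrB -!sumf.
have := sumf (fun=> 1); rewrite -!mulr_suml !mulr1 W1 => <-.
rewrite gerDl subr_le0 => h.
rewrite -ler_pdivrMl //; apply: le_trans h.
(* Messages outside the image have an empty cell and contribute zero. *)
rewrite mulr_sumr (bigID (mem (codom f))) /= addrC big1 ?add0r => [|m mf].
  by rewrite (sumf (fun m => V m / 16)); apply: ler_sum => m _; rewrite mulrC mulrA.
rewrite /q big_pred0 ?mul0r ?mulr0 // => x; apply: contraNF mf => /eqP <-.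
exact: codom_f.
Qed.

End LevelOne.

(** * Deterministic codes on the cube *)

Section Cube.
Variables (R : realType) (d : nat).

Notation cube := {ffun 'I_d -> bool}.

Definition sgn (b : bool) : R := if b then -1 else 1.

Definition flip (j : 'I_d) (t : cube) : cube := [ffun k => t k (+) (k == j)].

Lemma flipK j : involutive (flip j).
Proof. by move=> t; apply/ffunP => k; rewrite !ffunE -addbA addbb addbF. Qed.

Variable delta : R.
Hypothesis delta_ge0 : 0 <= delta.
Hypothesis delta_le : delta <= 2^-1.

Ltac delta_lra := move: delta_ge0 delta_le; lra.

Definition bit_weight (a b : bool) : R := (1 + sgn (a (+) b) * delta) / 2.

(* Flipping the bit [a] multiplies [bit_weight a b] by [1 - 2 * delta * score a b]. *)
Definition score (a b : bool) : R :=
  sgn (a (+) b) / (1 + sgn (a (+) b) * delta).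

Definition cube_weight (t x : cube) : R := \prod_j bit_weight (t j) (x j).

Lemma bit_weight_gt0 a b : 0 < bit_weight a b.
Proof.
by rewrite divr_gt0 // /sgn; case: (a (+) b) => /=; delta_lra.
Qed.

Lemma sum_bit_weight a : \sum_b bit_weight a b = 1.
Proof.
by rewrite big_bool /bit_weight /sgn; case: a; rewrite /=; field.
Qed.

Lemma sum_bit_weight_sgn a : \sum_b bit_weight a b * sgn b = delta * sgn a.
Proof.
by rewrite big_bool /bit_weight /sgn; case: a; rewrite /=; field.
Qed.

Lemma score_mean0 a : \sum_b bit_weight a b * score a b = 0.
Proof.
have p : 1 + delta != 0 by apply: lt0r_neq0; delta_lra.
have m : 1 - delta != 0 by apply: lt0r_neq0; delta_lra.
rewrite big_bool /bit_weight /score /sgn.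
by case: a; rewrite /= ?mulN1r ?mul1r; field; rewrite ?m ?p.
Qed.

Lemma score_bounded a b : `|score a b| <= 2.
Proof.
have p : 0 < 1 + sgn (a (+) b) * delta.
  by rewrite /sgn; case: (a (+) b) => /=; delta_lra.
rewrite /score normrM normfV (gtr0_norm p).
have -> : `|sgn (a (+) b)| = 1 by rewrite /sgn; case: ifP; rewrite ?normrN1 ?normr1.
rewrite mul1r.
rewrite -[2]invrK lef_pV2 ?posrE ?invr_gt0 //.
by move: p; rewrite /sgn; case: (a (+) b) => /=; delta_lra.
Qed.

Lemma score_var a : \sum_b bit_weight a b * score a b ^+ 2 <= 2.
Proof.
have p : 1 + delta != 0 by apply: lt0r_neq0; delta_lra.
have m : 1 - delta != 0 by apply: lt0r_neq0; delta_lra.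
have q : 0 < 1 - delta ^+ 2.
  rewrite (_ : _ - _ = (1 - delta) * (1 + delta)); last by ring.
  by apply: mulr_gt0; delta_lra.
have -> : \sum_b bit_weight a b * score a b ^+ 2 = (1 - delta ^+ 2)^-1.
  rewrite big_bool /bit_weight /score /sgn.
  by case: a; rewrite /= ?mulN1r ?mul1r; field; rewrite ?m ?p ?lt0r_neq0.
rewrite -[2]invrK lef_pV2 ?posrE ?invr_gt0 //.
have : delta ^+ 2 <= 2^-1 ^+ 2 by rewrite ler_sqr ?nnegrE ?invr_ge0.
by delta_lra.
Qed.

Lemma cube_weight_gt0 t x : 0 < cube_weight t x.
Proof. by apply: prodr_gt0 => j _; exact: bit_weight_gt0. Qed.

Lemma sum_cube_weight t : \sum_x cube_weight t x = 1.
Proof.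
by rewrite (sum_prod_ffun (fun j => bit_weight (t j))) big1 // => j _;
  exact: sum_bit_weight.
Qed.

Lemma sum_cube_weight_sgn t j :
  \sum_x cube_weight t x * sgn (x j) = delta * sgn (t j).
Proof.
rewrite (sum_prod_ffun1 (w := fun j => bit_weight (t j)) j sgn).
  exact: sum_bit_weight_sgn.
by move=> i; exact: sum_bit_weight.
Qed.

Lemma cube_weight_flip j t x :
  cube_weight (flip j t) x = cube_weight t x * (1 - 2 * delta * score (t j) (x j)).
Proof.
rewrite /cube_weight (bigD1 j) //= [in RHS](bigD1 j) //= [RHS]mulrAC; congr (_ * _).
  rewrite ffunE eqxx addbT /bit_weight /score addNb /sgn.
  have p : 1 + delta != 0 by apply: lt0r_neq0; delta_lra.
  have m : 1 - delta != 0 by apply: lt0r_neq0; delta_lra.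
  by case: (t j (+) x j); rewrite /= ?mulN1r ?mul1r; field.
by apply: eq_bigr => k kj; rewrite ffunE (negPf kj) addbF.
Qed.

Variables (n : nat) (Msg : finType).
Variables (f : 'I_n -> cube -> Msg) (len : Msg -> R).
Hypothesis kraft : forall i, \sum_(m | m \in codom (f i)) expR (- len m) <= 1.

(** Under the parameter [t], [Q] is the law of the message of client [i], [v] the conditional mean
    of the score of bit [j] given the message, [L] the likelihood ratio of [flip j t] to [t], and
    [chi] the resulting chi-square distance. On a message of mass zero, division by zero gives
    [v = 0] and [L = 1]. *)
Let Q (t : cube) i m : R := \sum_(x | f i x == m) cube_weight t x.

Let v (t : cube) j i m : R :=
  (\sum_(x | f i x == m) cube_weight t x * score (t j) (x j)) / Q t i m.

Let L (t : cube) j i m : R := 1 - 2 * delta * v t j i m.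

Let chi (t : cube) j i : R := \sum_m Q t i m * (2 * delta * v t j i m) ^+ 2.

Let Q_ge0 t i m : 0 <= Q t i m.
Proof. by apply: sumr_ge0 => x _; exact/ltW/cube_weight_gt0. Qed.

Let sumQ t i : \sum_m Q t i m = 1.
Proof.
by rewrite -(sum_cube_weight t) (partition_big (f i) xpredT).
Qed.

Let Q0_pred0 t i m : Q t i m = 0 -> (fun x => f i x == m) =1 xpred0.
Proof.
move=> Q0 x; apply: contra_eqF Q0 => fx.
rewrite gt_eqF // /Q (bigD1 x) //= ltr_pwDl ?cube_weight_gt0 //.
by apply: sumr_ge0 => y _; exact/ltW/cube_weight_gt0.
Qed.

(** Sum [cube_weight_flip] over a cell. All weights being positive, mass zero means an empty cell,
    which has mass zero for [flip j t] as well. *)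
Let Q_flip t j i m : Q (flip j t) i m = Q t i m * L t j i m.
Proof.
have [Q0|Q0] := eqVneq (Q t i m) 0.
  by rewrite Q0 mul0r /Q big_pred0 //; exact: Q0_pred0 Q0.
rewrite /L mulrBr mulr1 mulrCA /v [Q t i m * _]mulrC mulfVK // /Q.
rewrite mulr_sumr -sumrB; apply: eq_bigr => x _.
by rewrite cube_weight_flip; ring.
Qed.

Let L_ge0 t j i m : 0 <= L t j i m.
Proof.
have [Q0|Q0] := eqVneq (Q t i m) 0.
  by rewrite /L /v Q0 invr0 mulr0 mulr0 subr0.
by rewrite -(pmulr_rge0 _ (_ : 0 < Q t i m)) ?lt_def ?Q0 ?Q_ge0 // -Q_flip Q_ge0.
Qed.

Let sumQL t j i : \sum_m Q t i m * L t j i m = 1.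
Proof. by under eq_bigr do rewrite -Q_flip; exact: sumQ. Qed.

Let sumQL2 t j i : \sum_m Q t i m * L t j i m ^+ 2 = 1 + chi t j i.
Proof.
transitivity (\sum_m (2 * (Q t i m * L t j i m) - Q t i m +
    Q t i m * (2 * delta * v t j i m) ^+ 2)).
  by apply: eq_bigr => m _; rewrite /L; ring.
by rewrite !big_split /= sumrN -mulr_sumr sumQL sumQ -/(chi t j i); ring.
Qed.

(** The constant 64 is the 16 of [level_one_code] times the 4 of [(2 * delta) ^+ 2]. *)
Let sum_chi t i :
  \sum_j chi t j i <= 64 * delta ^+ 2 * \sum_x cube_weight t x * len (f i x).
Proof.
have h := level_one_code (w := fun j => bit_weight (t j)) (g := fun j => score (t j))
  (fun _ _ => ltW (bit_weight_gt0 _ _)) (fun _ => sum_bit_weight _)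
  (fun _ => score_mean0 _) (fun _ => score_var _) (fun _ _ => score_bounded _ _)
  (kraft i).
have -> : 64 * delta ^+ 2 * \sum_x cube_weight t x * len (f i x) =
    4 * delta ^+ 2 * (16 * \sum_x cube_weight t x * len (f i x)) by ring.
apply: le_trans (ler_wpM2l _ h); last by rewrite mulr_ge0 ?sqr_ge0.
rewrite exchange_big /= mulr_sumr; apply: ler_sum => m _.
rewrite !mulr_sumr; apply: ler_sum => j _; rewrite -/(Q t i m) -/(v t j i m).
rewrite le_eqVlt; apply/orP; left; apply/eqP; ring.
Qed.

(** The data sets with a given message vector form a product of cells, so the sum over them factors
    over the clients. *)
Let pushforward t (H : {ffun 'I_n -> Msg} -> R) :
  \sum_(X : {ffun 'I_n -> cube})
     \prod_i cube_weight t (X i) * H [ffun i => f i (X i)] =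
  \sum_(M : {ffun 'I_n -> Msg}) \prod_i Q t i (M i) * H M.
Proof.
rewrite (partition_big (fun X : {ffun 'I_n -> cube} => [ffun i => f i (X i)]) xpredT) //=.
apply: eq_bigr => M _; rewrite /Q bigA_distr_big_dep mulr_suml.
apply: eq_big => [X|X /eqP ->] //.
apply/eqP/familyP => [<- i|h]; first by rewrite unfold_in ffunE.
by apply/ffunP => i; rewrite ffunE; apply/eqP; exact: h.
Qed.

Variable T : 'I_d -> {ffun 'I_n -> Msg} -> R.

Let err (t : cube) j : R := \sum_(M : {ffun 'I_n -> Msg})
  \prod_i Q t i (M i) * (T j M - delta * sgn (t j)) ^+ 2.

Let err_pair t j :
  2 * delta ^+ 2 * (1 - 2 * \sum_i chi t j i) <= err t j + err (flip j t) j.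
Proof.
have chi_ge0 i : 0 <= chi t j i.
  by apply: sumr_ge0 => m _; rewrite mulr_ge0 ?sqr_ge0.
have := two_point (T j) (delta * sgn (t j)) (delta * sgn (flip j t j))
  (Q_ge0 t) (L_ge0 t j) (sumQL t j) (sumQL2 t j) chi_ge0.
have -> : err (flip j t) j = \sum_(M : {ffun 'I_n -> Msg})
    \prod_i (Q t i (M i) * L t j i (M i)) * (T j M - delta * sgn (flip j t j)) ^+ 2.
  by apply: eq_bigr => M _; congr (_ * _); apply: eq_bigr => i _; exact: Q_flip.
apply: le_trans; rewrite ffunE eqxx addbT /sgn.
by case: (t j); rewrite /=; lra.
Qed.

(** An argument of Assouad type: flipping bit [j] permutes the parameters, so the total error is
    half the sum over the pairs [t], [flip j t]; [sum_chi] then bounds the distances over all bits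
    at once. *)
Lemma sum_err_ge :
  \sum_t delta ^+ 2 * (d%:R -
     128 * delta ^+ 2 * \sum_i \sum_x cube_weight t x * len (f i x)) <=
  \sum_t \sum_j err t j.
Proof.
have -> : \sum_t \sum_j err t j = 2^-1 * \sum_t \sum_j (err t j + err (flip j t) j).
  have h : \sum_t \sum_j err (flip j t) j = \sum_t \sum_j err t j.
    rewrite exchange_big [RHS]exchange_big; apply: eq_bigr => j _.
    by rewrite [RHS](reindex_inj (inv_inj (flipK j))).
  have -> : \sum_t \sum_j (err t j + err (flip j t) j) =
      \sum_t \sum_j err t j + \sum_t \sum_j err t j.
    rewrite -[X in _ = _ + X]h -big_split /=; apply: eq_bigr => t _.
    by rewrite big_split.
  by field.
rewrite mulr_sumr; apply: ler_sum => t _.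
apply: le_trans (_ : 2^-1 * \sum_j 2 * delta ^+ 2 * (1 - 2 * \sum_i chi t j i) <= _);
  last by rewrite ler_pM2l ?invr_gt0 //; apply: ler_sum => j _; exact: err_pair.
have h : \sum_j \sum_i chi t j i <= 64 * delta ^+ 2 *
    \sum_i \sum_x cube_weight t x * len (f i x).
  by rewrite exchange_big [leRHS]mulr_sumr; apply: ler_sum => i _; exact: sum_chi.
have -> : \sum_j 2 * delta ^+ 2 * (1 - 2 * \sum_i chi t j i) =
    2 * (delta ^+ 2 * (d%:R - 2 * \sum_j \sum_i chi t j i)).
  by rewrite -mulr_sumr sumrB sumr_const card_ord -mulr_sumr; ring.
rewrite mulKf //; apply: ler_wpM2l; first exact: sqr_ge0.
lra.
Qed.

Hypotheses (n_gt0 : (0 < n)%N) (d_gt0 : (0 < d)%N).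

Let PX (t : cube) (X : {ffun 'I_n -> cube}) : R := \prod_i cube_weight t (X i).

Let PX_ge0 t X : 0 <= PX t X.
Proof. by apply: prodr_ge0 => i _; exact/ltW/cube_weight_gt0. Qed.

Let sumPX t : \sum_X PX t X = 1.
Proof.
rewrite (sum_prod_ffun (fun (_ : 'I_n) => cube_weight t)) big1 // => i _.
exact: sum_cube_weight.
Qed.

Let data_mean (X : {ffun 'I_n -> cube}) j : R := n%:R^-1 * \sum_i sgn (X i j).

Let data_mean_err t j :
  \sum_X PX t X * (data_mean X j - delta * sgn (t j)) ^+ 2 <= n%:R^-1.
Proof.
have n0 : n%:R != 0 :> R by rewrite pnatr_eq0 -lt0n.
have := sum_prod_sqr_le (fun _ : 'I_n => fun x : cube => sgn (x j))
  (n%:R * (delta * sgn (t j))) (fun _ : 'I_n => fun x => ltW (cube_weight_gt0 t x))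
  (fun=> sum_cube_weight t).
have -> : \sum_(i < n) \sum_(x : cube) cube_weight t x * sgn (x j) =
    n%:R * (delta * sgn (t j)).
  rewrite (eq_bigr _ (fun i _ => sum_cube_weight_sgn t j)).
  by rewrite sumr_const card_ord mulr_natl.
rewrite subrr expr0n addr0.
have -> : \sum_(i < n) \sum_(x : cube) cube_weight t x * sgn (x j) ^+ 2 = n%:R.
  rewrite (eq_bigr (fun=> 1)) ?sumr_const ?card_ord // => i _.
  rewrite -(sum_cube_weight t); apply: eq_bigr => x _.
  by rewrite /sgn; case: (x j); rewrite ?sqrrN expr1n mulr1.
move=> h.
have -> : \sum_X PX t X * (data_mean X j - delta * sgn (t j)) ^+ 2 =
    n%:R ^- 2 * \sum_(X : {ffun 'I_n -> cube}) \prod_i cube_weight t (X i) *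
       (\sum_i sgn (X i j) - n%:R * (delta * sgn (t j))) ^+ 2.
  rewrite mulr_sumr; apply: eq_bigr => X _; rewrite /data_mean /PX.
  set S := \sum_i _; set P := \prod_i _; field; exact: n0.
rewrite -(_ : n%:R ^- 2 * n%:R = n%:R^-1); last by field; exact: n0.
by apply: ler_wpM2l => //; rewrite invr_ge0 exprn_ge0.
Qed.

Definition prior (X : {ffun 'I_n -> cube}) : R :=
  (\sum_t \prod_i cube_weight t (X i)) / #|{: cube}|%:R.

Let card_cube_gt0 : 0 < #|{: cube}|%:R :> R.
Proof. by rewrite ltr0n; apply/card_gt0P; exists [ffun=> true]. Qed.

Lemma prior_ge0 X : 0 <= prior X.
Proof. by rewrite divr_ge0 // sumr_ge0 // => t _; exact: PX_ge0. Qed.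

Lemma sum_prior : \sum_X prior X = 1.
Proof.
rewrite -mulr_suml exchange_big /= (eq_bigr (fun=> 1)) => [|t _]; last exact: sumPX.
by rewrite sumr_const divff // lt0r_neq0.
Qed.

(** The error about the parameter is turned into an error about the data mean at the price of
    [n%:R^-1]. The cost stands as a penalty inside the average, so that the inequality, valid for
    each fixed seed, can be integrated over the seeds. *)
Lemma bayes_risk_ge :
  delta ^+ 2 / 2 - n%:R^-1 <=
  \sum_X prior X *
    ((\sum_j (T j [ffun i => f i (X i)] - data_mean X j) ^+ 2) / d%:R +
     64 * delta ^+ 4 / d%:R * \sum_i len (f i (X i))).
Proof.
have d0 : 0 < d%:R :> R by rewrite ltr0n.
pose Lam t := \sum_i \sum_x cube_weight t x * len (f i x).
(* With [y] the estimate, [z] the data mean and [a] the parameter, [(y - a) ^+ 2 / 2 <= (y - z) ^+ 2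
   + (z - a) ^+ 2]; the last term averages to at most [n%:R^-1]. *)
have half t j : err t j / 2 - n%:R^-1 <=
    \sum_X PX t X * (T j [ffun i => f i (X i)] - data_mean X j) ^+ 2.
  apply: le_trans (lerB (lexx _) (data_mean_err t j)) _.
  rewrite /err -pushforward mulr_suml -sumrB; apply: ler_sum => X _.
  rewrite -/(PX t X) -subr_ge0; set a := delta * _; set y := T _ _; set z := data_mean _ _.
  rewrite (_ : _ - _ = PX t X * ((y - z - (z - a)) ^+ 2 / 2)); last by field.
  by rewrite mulr_ge0 // divr_ge0 ?sqr_ge0.
have step t : (\sum_j err t j) / 2 / d%:R - n%:R^-1 + 64 * delta ^+ 4 / d%:R * Lam t <=
    \sum_X PX t X *
    ((\sum_j (T j [ffun i => f i (X i)] - data_mean X j) ^+ 2) / d%:R +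
     64 * delta ^+ 4 / d%:R * \sum_i len (f i (X i))).
  under [leRHS]eq_bigr do rewrite mulrDr.
  rewrite big_split /=; apply: lerD.
    under [leRHS]eq_bigr do rewrite mulrA.
    rewrite -mulr_suml ler_pdivlMr // mulrBl mulfVK ?lt0r_neq0 //.
    under [leRHS]eq_bigr do rewrite mulr_sumr.
    rewrite [leRHS]exchange_big /=; apply: le_trans (ler_sum _ (fun j _ => half t j)).
    by rewrite sumrB sumr_const card_ord -mulr_suml mulr_natr.
  under [leRHS]eq_bigr do rewrite mulrCA.
  rewrite -mulr_sumr /Lam le_eqVlt; apply/orP; left; apply/eqP; congr (_ * _).
  under [RHS]eq_bigr do rewrite mulr_sumr.
  rewrite [RHS]exchange_big /=; apply: eq_bigr => i _.
  rewrite (sum_prod_ffun1 (w := fun=> cube_weight t) i (fun x => len (f i x))) // => _.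
  exact: sum_cube_weight.
rewrite /prior; under eq_bigr do rewrite mulrAC.
rewrite -mulr_suml ler_pdivlMr //.
under [leRHS]eq_bigr => X _ do rewrite (mulr_suml _ _ (PX^~ X)).
rewrite [leRHS]exchange_big /=.
apply: le_trans (ler_sum _ (fun t _ => step t)).
pose N : R := #|{: cube}|%:R; pose S := \sum_t Lam t; pose E := \sum_t \sum_j err t j.
have h : delta ^+ 2 * (d%:R * N - 128 * delta ^+ 2 * S) <= E.
  apply: le_trans sum_err_ge; rewrite -mulr_sumr sumrB sumr_const -mulr_sumr.
  by rewrite /N mulr_natr.
have -> : \sum_t ((\sum_j err t j) / 2 / d%:R - n%:R^-1 +
      64 * delta ^+ 4 / d%:R * Lam t) =
    E / 2 / d%:R - n%:R^-1 * N + 64 * delta ^+ 4 / d%:R * S.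
  rewrite big_split sumrB sumr_const -mulr_sumr -!mulr_suml.
  by rewrite /N mulr_natr.
move: h (d0); rewrite -/N; move: N S E (n%:R^-1) (d%:R) => N S E m D h D0.
rewrite -subr_ge0.
have -> : E / 2 / D - m * N + 64 * delta ^+ 4 / D * S - (delta ^+ 2 / 2 - m) * N =
    (E - delta ^+ 2 * (D * N - 128 * delta ^+ 2 * S)) / (2 * D).
  by field; rewrite lt0r_neq0.
by rewrite divr_ge0 ?subr_ge0 // mulr_ge0 // ltW.
Qed.

End Cube.

(** * Kraft's inequality *)

Lemma expRN1_le_half (R : realType) : expR (- 1) <= 2^-1 :> R.
Proof.
rewrite expRN lef_pV2 ?posrE ?expR_gt0 //; have := @expR_ge1Dx R 1; lra.
Qed.

Definition prefix_free (s : seq (seq bool)) :=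
  forall a b, a \in s -> b \in s -> prefix a b -> a = b.

(** Induction on a bound on the lengths, splitting by the first bit: each half, stripped of that
    bit, is again prefix-free and is weighted by [expR (- 1) <= 1/2]. Base e instead of 2 suits the
    exponential in [level_one]. *)
Lemma kraft_expR (R : realType) (s : seq (seq bool)) : uniq s -> prefix_free s ->
  \sum_(m <- s) expR (- (size m)%:R) <= 1 :> R.
Proof.
have [k sk] : exists k, forall m, m \in s -> (size m < k)%N.
  exists (\max_(m <- s) size m).+1 => m ms; rewrite ltnS.
  by rewrite (big_rem m) //= leq_maxl.
elim: k s sk => [|k IH] s sk us pf.
  case: s sk {us pf} => [|m s sk]; first by rewrite big_nil.
  by have := sk m; rewrite mem_head => /(_ isT).
(* The empty string is a prefix of every string, so if present it is the only word. *)
have [s0|s0] := boolP ([::] \in s).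
  have -> : s = [:: [::]].
    apply: perm_small_eq => //; apply: uniq_perm => // m; rewrite inE.
    by apply/idP/eqP => [ms|-> //]; apply/esym/(pf _ _ s0 ms)/prefix0s.
  by rewrite big_seq1 oppr0 expR0.
pose t b := [seq behead m | m <- s & head false m == b].
have cons_behead b m : m \in [seq m <- s | head false m == b] -> m = b :: behead m.
  rewrite mem_filter => /andP[/eqP <-]; case: m => // ms.
  by rewrite ms in s0.
have ut b : uniq (t b).
  rewrite map_inj_in_uniq ?filter_uniq // => x y /cons_behead -> /cons_behead -> /=.
  by move=> ->.
have mt b m : m \in t b -> b :: m \in s.
  case/mapP => m' m's ->; rewrite -(cons_behead _ _ m's).
  by move: m's; rewrite mem_filter => /andP[].
have tpf b : prefix_free (t b).
  move=> x y /mt xs /mt ys xy.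
  by have [] : b :: x = b :: y by apply: pf; rewrite // /= eqxx.
have tk b m : m \in t b -> (size m < k)%N by move=> /mt /sk.
have sumt b : \sum_(m <- s | head false m == b) expR (- (size m)%:R) =
    expR (- 1) * \sum_(m <- t b) expR (- (size m)%:R) :> R.
  rewrite /t big_map mulr_sumr -[LHS]big_filter; apply: eq_big_seq => m /cons_behead ->.
  by rewrite /= -expRD -natr1 opprD addrC.
have [/= h0 h1] := (IH _ (tk false) (ut false) (tpf false),
                    IH _ (tk true) (ut true) (tpf true)).
rewrite (bigID (fun m => head false m == false)) /= sumt.
rewrite [X in _ + X](eq_bigl (fun m => head false m == true)); last first.
  by move=> m; case: (head false m).
rewrite sumt; have := @expRN1_le_half R; have := expR_ge0 (- 1 : R).
set a := expR _; set x := \sum_(m <- t false) _; set y := \sum_(m <- t true) _.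
rewrite -mulrDr => a0 a2; apply: le_trans (_ : a * 2 <= _); last by lra.
by apply: ler_wpM2l => //; rewrite /x /y; lra.
Qed.

Lemma prefix_code_risk_ge (R : realType) (d n : nat) (delta : R)
    (F : 'I_n -> {ffun 'I_d -> bool} -> seq bool)
    (T : 'I_d -> n.-tuple (seq bool) -> R) :
  0 <= delta -> delta <= 2^-1 -> (0 < n)%N -> (0 < d)%N ->
  (forall i x y, prefix (F i x) (F i y) -> F i x = F i y) ->
  delta ^+ 2 / 2 - n%:R^-1 <=
  \sum_(X : {ffun 'I_n -> {ffun 'I_d -> bool}}) prior delta X *
    ((\sum_j (T j [tuple F i (X i) | i < n] - n%:R^-1 * \sum_i sgn R (X i j)) ^+ 2) / d%:R +
     64 * delta ^+ 4 / d%:R * \sum_i (size (F i (X i)))%:R).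
Proof.
move=> delta0 delta2 n0 d0 pf.
(* The cube is finite, so the lengths are bounded and the messages live in a finite type, as the
   argument on the cube requires. *)
pose K := \max_(p : 'I_n * {ffun 'I_d -> bool}) size (F p.1 p.2).
have FK i x : (size (F i x) <= K)%N.
  exact: (leq_bigmax (F := fun p : 'I_n * _ => size (F p.1 p.2)) (i, x)).
pose f i x : K.-bseq bool := Bseq (FK i x).
have kr i : \sum_(m | m \in codom (f i)) expR (- (size m)%:R) <= 1 :> R.
  have := @kraft_expR R [seq val m | m <- enum (mem (codom (f i)))].
  rewrite big_map big_enum /=; apply.
    by rewrite map_inj_uniq ?enum_uniq //; exact: val_inj.
  by move=> a b /mapP[a']; rewrite mem_enum => /codomP[x ->] ->
    /mapP[b']; rewrite mem_enum => /codomP[y ->] -> /=; exact: pf.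
have := bayes_risk_ge delta0 delta2 kr
  (fun j (M : {ffun 'I_n -> K.-bseq bool}) => T j [tuple val (M i) | i < n]) n0 d0.
move=> h; apply: le_trans h _; rewrite le_eqVlt; apply/orP; left; apply/eqP.
apply: eq_bigr => X _; congr (_ * (_ / _ + _)).
apply: eq_bigr => j _; congr ((T j _ - _) ^+ 2).
by apply: eq_from_tnth => i; rewrite !tnth_mktuple ffunE.
Qed.

(** * From deterministic codes to protocols *)

(** The preimage of [B] is a countable union over the values of [h]. Functions of the messages are
    thus handled without a sigma-algebra on bit strings. *)
Lemma measurable_fun_countable_case d d' (T : measurableType d)
    (U : measurableType d') (C : countType) (h : T -> C) (g : C -> T -> U) :
  (forall c, measurable [set t | h t = c]) ->
  (forall c, measurable_fun setT (g c)) ->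
  measurable_fun setT (fun t => g (h t) t).
Proof.
move=> mh mg _ B mB; rewrite setTI.
have -> : (fun t => g (h t) t) @^-1` B =
    \bigcup_c ([set t | h t = c] `&` g c @^-1` B).
  by apply/seteqP; split => [t Bt|t [c _ [/= <-]] //]; exists (h t).
apply: countable_bigcupT_measurable; first exact: countableP.
by move=> c; apply: measurableI => //; rewrite -[X in measurable X]setTI; exact: mg.
Qed.

Lemma norm2_sqr (R : realType) (d : nat) (x : 'rV[R]_d) :
  norm2 x ^+ 2 = \sum_(j < d) x ord0 j ^+ 2.
Proof. by rewrite sqr_sqrtr // sumr_ge0 // => j _; exact: sqr_ge0. Qed.

Lemma mean_coord (R : realType) (d n : nat) (X : 'I_n -> 'rV[R]_d) j :
  mean X ord0 j = n%:R^-1 * \sum_(i < n) X i ord0 j.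
Proof. by rewrite mxE summxE. Qed.

Section ProtocolMeasurability.
Variables (R : realType) (d n : nat) (pi : protocol R d n).
Variable X : 'I_n -> 'rV[R]_d.

Let W : measurableType _ := (pub pi * n.-tuple (priv pi))%type.

Lemma measurable_message (i : 'I_n) (m : seq bool) :
  measurable [set w : W | message X i w = m].
Proof.
pose g (w : W) := (w.1, tnth w.2 i).
have mg : measurable_fun setT g.
  apply: measurable_fun_pair; first exact: measurable_fst.
  apply: (measurableT_comp (f := fun t : n.-tuple (priv pi) => tnth t i)).
    exact: measurable_tnth.
  exact: measurable_snd.
have := mg measurableT _ (encode_measurable (p := pi) i (X i) m).
by rewrite setTI.
Qed.

Lemma measurable_size_message (i : 'I_n) :
  measurable_fun setT (fun w : W => (size (message X i w))%:R : R).
Proof.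
apply: (@measurable_fun_countable_case _ _ _ _ _ (message X i)
  (fun m _ => (size m)%:R : R)).
  exact: measurable_message.
by move=> m; exact: measurable_cst.
Qed.

Lemma measurable_sqr_error :
  measurable_fun setT (fun w : W => norm2 (estimate X w - mean X) ^+ 2).
Proof.
pose h (w : W) : n.-tuple (seq bool) := [tuple message X i w | i < n].
(* With the messages frozen to [M], the error depends on the public seed only, through the
   coordinates of [decode]. *)
pose g (M : n.-tuple (seq bool)) (w : W) : R := norm2 (Defs.decode (p := pi) w.1 M - mean X) ^+ 2.
apply: (@measurable_fun_countable_case _ _ W R _ h g) => M.
  have -> : [set w : W | h w = M] =
      \bigcap_(i in [set: 'I_n]) [set w : W | message X i w = tnth M i].
    apply/seteqP; split => [w /= <- i _ /=|w /= hw]; first by rewrite tnth_mktuple.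
    by apply: eq_from_tnth => i; rewrite tnth_mktuple; exact: hw.
  by apply: fin_bigcap_measurable => // i _; exact: measurable_message.
rewrite /g; under eq_fun do rewrite norm2_sqr.
apply: measurable_sum => j; apply: measurable_funX.
under eq_fun do rewrite !mxE.
apply: measurable_funB; last exact: measurable_cst.
apply: (measurableT_comp (f := fun u => Defs.decode (p := pi) u M ord0 j)).
  exact: decode_measurable.
exact: measurable_fst.
Qed.

End ProtocolMeasurability.

Lemma product_setT (R : realType) (d n : nat) (pi : protocol R d n) :
  (pub_law pi \x priv_law pi)%E setT = 1%E.
Proof. by rewrite -setXTT product_measure1E //= !probability_setT mule1. Qed.

Section LowerBound.
Variables (R : realType) (d n : nat).
Hypotheses (n_gt0 : (0 < n)%N) (d_gt0 : (0 < d)%N).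

Notation cube := {ffun 'I_d -> bool}.

Definition cube_point (x : cube) : 'rV[R]_d :=
  \row_j (sgn R (x j) / Num.sqrt d%:R).

Let sqrtd_gt0 : 0 < Num.sqrt (d%:R : R).
Proof. by rewrite sqrtr_gt0 ltr0n. Qed.

Lemma cube_point_ball x : unit_ball (cube_point x).
Proof.
rewrite /unit_ball /= -[X in _ <= X]sqrtr1 ler_sqrt //.
under eq_bigr => j _.
  rewrite mxE expr_div_n sqr_sqrtr ?ler0n //.
  rewrite (_ : sgn R (x j) ^+ 2 = 1); last by rewrite /sgn; case: (x j); rewrite ?sqrrN expr1n.
  over.
by rewrite sumr_const card_ord mul1r -(mulr_natr d%:R^-1) mulVf // pnatr_eq0 -lt0n.
Qed.

(** For fixed seeds the protocol is a family of prefix-free codes, to which [prefix_code_risk_ge]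
    applies. The bound is integrated over the seeds, and the integral is exchanged with the finite
    average over [prior]; then each error is at most the worst one and each cost at most [c]. *)
Lemma cost_error_tradeoff (pi : protocol R d n) (delta c : R) :
  0 <= delta -> delta <= 2^-1 -> 0 <= c -> cost_at_most c pi ->
  ((delta ^+ 2 / 2 - n%:R^-1 - 64 * delta ^+ 4 / d%:R * c)%:E <= worst_error pi)%E.
Proof.
move=> delta0 delta2 c0 hc.
pose P := (pub_law pi \x priv_law pi)%E.
pose K := 64 * delta ^+ 4 / d%:R.
have K0 : 0 <= K by rewrite divr_ge0 ?mulr_ge0 ?exprn_ge0.
pose V (X : {ffun 'I_n -> cube}) i := cube_point (X i).
have Vball X : ball_data (V X) by move=> i; exact: cube_point_ball.
pose err X (w : pub pi * n.-tuple (priv pi)) : R := norm2 (estimate (V X) w - mean (V X)) ^+ 2.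
pose len X i (w : pub pi * n.-tuple (priv pi)) : R := (size (message (V X) i w))%:R.
have pointwise w : delta ^+ 2 / 2 - n%:R^-1 <=
    \sum_X prior delta X * (err X w + K * \sum_i len X i w).
  (* The points are signs divided by sqrt(d), so the output of the server is multiplied by sqrt(d);
     the division by [d] restores the squared norm. *)
  have := @prefix_code_risk_ge R d n delta
    (fun i x => encode (p := pi) i w.1 (tnth w.2 i) (cube_point x))
    (fun j M => Num.sqrt d%:R * Defs.decode (p := pi) w.1 M ord0 j)
    delta0 delta2 n_gt0 d_gt0 (fun i x y => @encode_prefix_free _ _ _ pi i w.1 _ _ _ _).
  move/le_trans; apply; rewrite le_eqVlt; apply/orP; left; apply/eqP.
  apply: eq_bigr => X _; congr (_ * (_ + _)).
  rewrite /err norm2_sqr mulr_suml; apply: eq_bigr => j _.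
  have -> : (estimate (V X) w - mean (V X)) ord0 j = estimate (V X) w ord0 j -
      n%:R^-1 * (\sum_i sgn R (X i j)) / Num.sqrt d%:R.
    rewrite 2!mxE mean_coord -mulrA mulr_suml; congr (_ - _ * _).
    by apply: eq_bigr => i _; rewrite mxE.
  rewrite -[X in _ / X = _](@sqr_sqrtr R) ?ler0n // -expr_div_n; congr (_ ^+ 2).
  by rewrite mulrBl [X in X - _]mulrAC divff ?gt_eqF // mul1r.
have merr X : measurable_fun setT (EFin \o err X).
  by apply/measurable_EFinP; exact: measurable_sqr_error.
have mlen X i : measurable_fun setT (EFin \o len X i).
  by apply/measurable_EFinP; exact: measurable_size_message.
have err0 X w : 0 <= err X w by exact: sqr_ge0.
have len0 X i w : 0 <= len X i w by exact: ler0n.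
have pr0 X : 0 <= prior delta X by exact: prior_ge0.
have intX X : (\int[P]_w (err X w + K * \sum_i len X i w)%:E =
    mse pi (V X) + K%:E * cost pi (V X))%E.
  rewrite (eq_integral (fun w => (err X w)%:E + K%:E * \sum_i (len X i w)%:E)%E);
    last by move=> w _; rewrite sumEFin -EFinM -EFinD.
  rewrite ge0_integralD //=; first last.
  - apply: emeasurable_funM; first exact: measurable_cst.
    by apply: emeasurable_sum => i; exact: mlen.
  - by move=> w _; rewrite mule_ge0 ?lee_fin // sume_ge0 // => i _; rewrite lee_fin.
  - exact: merr.
  - by move=> w _; rewrite lee_fin.
  congr (_ + _)%E; rewrite ge0_integralZl_EFin //=; first last.
  - by apply: emeasurable_sum => i; exact: mlen.
  - by move=> w _; rewrite sume_ge0 // => i _; rewrite lee_fin.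
  congr (_ * _)%E; rewrite ge0_integral_sum //.
  - by move=> i; exact: mlen.
  - by move=> i w _; rewrite lee_fin.
pose kappa := delta ^+ 2 / 2 - n%:R^-1; rewrite -/kappa -/K.
have cX X : (K%:E * cost pi (V X) <= (K * c)%:E)%E.
  by rewrite (EFinM K c) lee_wpmul2l ?lee_fin //; apply: hc.
have eX X : (mse pi (V X) <= worst_error pi)%E.
  by apply: ereal_sup_ubound; exists (V X).
have worst0 : (0 <= worst_error pi)%E.
  apply: le_trans (eX [ffun=> [ffun=> true]]).
  by apply: integral_ge0 => w _; rewrite lee_fin sqr_ge0.
(* For negative [kappa] the nonnegativity of the error suffices; otherwise the constant [kappa] is a
   nonnegative integrand. *)
have [kappa0|kappa0] := ltP kappa 0.
  by apply: le_trans worst0; rewrite lee_fin; have := mulr_ge0 K0 c0; lra.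
have mrisk X : measurable_fun setT (fun w => (err X w + K * \sum_i len X i w)%:E).
  apply/measurable_EFinP; apply: measurable_funD.
    exact: measurable_sqr_error.
  apply: measurable_funM; first exact: measurable_cst.
  by apply: measurable_sum => i; exact: measurable_size_message.
have risk0 X w : 0 <= err X w + K * \sum_i len X i w.
  by rewrite addr_ge0 // mulr_ge0 // sumr_ge0.
have total : (kappa%:E <=
    \sum_X (prior delta X)%:E * (mse pi (V X) + K%:E * cost pi (V X)))%E.
  have -> : (kappa%:E = \int[P]_w (cst kappa%:E) w)%E.
    by rewrite integral_cst //= product_setT mule1.
  under eq_bigr => X _.
    rewrite -intX -ge0_integralZl_EFin //=; last by move=> w _; rewrite lee_fin.
    over.
  rewrite -ge0_integral_sum //=; first last.
  - by move=> X w _; rewrite mule_ge0 // lee_fin.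
  - by move=> X; apply: emeasurable_funM => //; exact: measurable_cst.
  apply: ge0_le_integral => //=.
  - by apply: emeasurable_sum => X; apply: emeasurable_funM => //; exact: measurable_cst.
  - move=> w _; under eq_bigr do rewrite -EFinM.
    by rewrite sumEFin lee_fin; exact: pointwise.
move: worst0 eX; case: (worst_error pi) => [r| |] // _ eX; last by rewrite leey.
rewrite lee_fin lerBlDr -lee_fin; apply: le_trans total _.
apply: (@le_trans _ _ (\sum_X (prior delta X * (r + K * c))%:E)%E).
  apply: lee_sum => X _; rewrite (EFinM (prior delta X)).
  apply: lee_wpmul2l; first by rewrite lee_fin.
  by rewrite EFinD; apply: leeD.
by rewrite sumEFin -mulr_suml sum_prior ?mul1r.
Qed.

End LowerBound.

(** * Protocols with finite public randomness *)

Section FiniteLaw.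
Variables (R : realType) (Omega : finType) (w : Omega -> R) (o : Omega).
Hypothesis w_ge0 : forall x, 0 <= w x.
Hypothesis w_sum1 : \sum_x w x = 1.

Let point (k : nat) : Omega := nth o (enum Omega) k.

(** The law is carried by [nat], where every set is measurable: the element of rank [k] in the
    enumeration of [Omega] becomes a point mass at [k]. *)
Definition finite_law : set nat -> \bar R :=
  msum (fun k => mscale (NngNum (w_ge0 (point k))) \d_k) #|Omega|.

HB.instance Definition _ := Measure.on finite_law.

Let sum_point (F : Omega -> R) : \sum_(k < #|Omega|) F (point k) = \sum_x F x.
Proof.
rewrite -[RHS]big_enum (big_nth o) big_mkord -cardE; exact: eq_bigr.
Qed.

Let finite_law_setT : finite_law setT = 1%E.
Proof.
rewrite /finite_law /msum -[1%E]/(1%:E) -w_sum1 -sum_point -sumEFin.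
apply: eq_bigr => k _; rewrite -[RHS]mule1; congr (_ * _)%E; exact: diracT.
Qed.

HB.instance Definition _ :=
  Measure_isProbability.Build _ _ R finite_law finite_law_setT.

Lemma integral_finite_law (F : Omega -> R) : (forall x, 0 <= F x) ->
  (\int[finite_law]_k (F (point k))%:E = (\sum_x w x * F x)%:E)%E.
Proof.
move=> F0; rewrite ge0_integral_measure_sum //=; last 1 first.
  by move=> k _; rewrite lee_fin.
rewrite -(sum_point (fun x => w x * F x)) -sumEFin; apply: eq_bigr => k _.
rewrite ge0_integral_mscale //=; last by move=> j _; rewrite lee_fin.
by rewrite integral_dirac //= diracT mul1e EFinM.
Qed.

Variables (d n : nat).
Variable code : 'I_n -> Omega -> 'rV[R]_d -> seq bool.
Hypothesis code_prefix_free : forall i u x y,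
  prefix (code i u x) (code i u y) -> code i u x = code i u y.
Variable server : Omega -> n.-tuple (seq bool) -> 'rV[R]_d.

Let t0 : n.-tuple unit := [tuple tt | i < n].

Let priv_indep (A : 'I_n -> set unit) : (forall i, measurable (A i)) ->
  fine ((\d_t0 : probability (n.-tuple unit) R) [set r | forall i, A i (tnth r i)]) =
  \prod_(i < n) fine ((\d_t0 : probability (n.-tuple unit) R) [set r | A i (tnth r i)]).
Proof.
move=> _.
have dE B : (\d_t0 : probability (n.-tuple unit) R) B = (t0 \in B)%:R%:E by exact: diracE.
rewrite dE; have [h|/existsNP[i hi]] := pselect (forall i, A i (tnth t0 i)).
  by rewrite mem_set // big1 // => i _; rewrite [X in fine X](dE _) mem_set //; exact: h.
rewrite memNset; last by move/(_ i).
by apply/esym/eqP/prodf_eq0; exists i => //; rewrite [X in fine X](dE _) memNset.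
Qed.

Definition public_protocol : protocol R d n.
refine (@Protocol R d n _ nat finite_law _ unit (\d_t0) priv_indep
  (fun i k _ x => code i (point k) x) _ _
  (fun k M => server (point k) M) _).
- move=> i x m.
  rewrite (_ : [set _ | _] = [set k | code i (point k) x = m] `*` setT).
    exact: measurableX.
  by apply/seteqP; split => // p [].
- by move=> i u _ _ x y; exact: code_prefix_free.
- by [].
Defined.

Lemma integral_public (F : Omega -> R) : (forall x, 0 <= F x) ->
  (\int[pub_law public_protocol \x priv_law public_protocol]_p (F (point p.1))%:E =
   (\sum_x w x * F x)%:E)%E.
Proof.
move=> F0; rewrite fubini_tonelli1 /=; first last.
- by move=> p; rewrite lee_fin.
- apply: (measurableT_comp (f := fun k : nat => (F (point k))%:E)) => //.
rewrite /fubini_F /= -integral_finite_law //; apply: eq_integral => k _.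
by rewrite integral_cst //= diracT mule1.
Qed.

Lemma cost_public X : cost public_protocol X =
  (\sum_x w x * \sum_i (size (code i x (X i)))%:R)%:E.
Proof.
under [in RHS]eq_bigr do rewrite mulr_sumr.
rewrite exchange_big -sumEFin; apply: eq_bigr => i _ /=.
by rewrite -(integral_public (F := fun x => (size (code i x (X i)))%:R)).
Qed.

Lemma mse_public X : mse public_protocol X =
  (\sum_x w x * norm2 (server x [tuple code i x (X i) | i < n] - mean X) ^+ 2)%:E.
Proof.
rewrite -(integral_public
  (F := fun x => norm2 (server x [tuple code i x (X i) | i < n] - mean X) ^+ 2)) // => x.
exact: sqr_ge0.
Qed.

Lemma minimax_error_le (c e : R) :
  (forall X, ball_data X -> \sum_x w x * \sum_i (size (code i x (X i)))%:R <= c) ->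
  (forall X, ball_data X ->
    \sum_x w x * norm2 (server x [tuple code i x (X i) | i < n] - mean X) ^+ 2 <= e) ->
  (minimax_error d n c <= e%:E)%E.
Proof.
move=> hc he; apply: le_trans (ereal_inf_lbound _) _.
  exists public_protocol; last reflexivity.
  by move=> X /hc; rewrite cost_public lee_fin.
by apply: ub_ereal_sup => _ [X /he hX <-]; rewrite mse_public lee_fin.
Qed.

End FiniteLaw.

(** * Sampling and quantization *)

(** The terminating [false] makes the code self-delimiting, so that concatenations can be parsed;
    the length [|z| + 2] is linear in [|z|], in line with an l1 bound. *)
Definition unary (z : int) : seq bool :=
  (z < 0) :: rcons (nseq `|z|%N true) false.

Lemma unary_cat_inj z z' a b : unary z ++ a = unary z' ++ b -> z = z' /\ a = b.
Proof.
have H (m m' : nat) : rcons (nseq m true) false ++ a = rcons (nseq m' true) false ++ b ->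
    m = m' /\ a = b.
  by elim: m m' => [|m IH] [|m'] //= [] // /IH[-> ->].
case=> sz /H[az ->]; split=> //.
by rewrite (intEsign z) (intEsign z') sz az.
Qed.

Definition unary_seq (s : seq int) : seq bool := flatten (map unary s).

Lemma unary_seq_prefix_free (s t : seq int) : size s = size t ->
  prefix (unary_seq s) (unary_seq t) -> s = t.
Proof.
move=> st /prefixP[r]; elim: s t st => [|x s IH] [|y t] //= [st].
rewrite /unary_seq /= -/(unary_seq s) -/(unary_seq t) -catA => e.
by have [-> /IH ->] := unary_cat_inj e.
Qed.

Section Rounding.
Variables (R : realType) (n : nat).
Hypothesis n_gt0 : (0 < n)%N.

(** A uniform dither with [n] values can only average to a multiple of [1 / n]. So [y] is first
    rounded down to such a multiple, at a bias of at most [1 / n]. *)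
Definition scaled_floor (y : R) : int := Num.floor (n%:R * y).

(* For integers [M = q n + r], the average over [k < n] of [q + (k < r)] is [M / n]. *)
Definition dither (k : 'I_n) (y : R) : int :=
  (scaled_floor y %/ n)%Z + (k%:Z < (scaled_floor y %% n)%Z)%R%:Z.

Let n0 : (n%:Z : int) != 0. Proof. by rewrite -lt0n. Qed.

Lemma sum_dither y : \sum_(k < n) (dither k y)%:~R = (scaled_floor y)%:~R :> R.
Proof.
rewrite -rmorph_sum; congr (_%:~R).
rewrite /dither; set M := scaled_floor y.
have [r Mr] : exists r : nat, (M %% n)%Z = r.
  by exists `|(M %% n)%Z|%N; rewrite gez0_abs // modz_ge0.
have rn : (r <= n)%N by rewrite -lez_nat -Mr; apply: ltW; exact: ltz_pmod.
rewrite big_split /= sumr_const card_ord [RHS](divz_eq M n) Mr.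
congr (_ + _); first by rewrite -mulr_natr natz.
rewrite -(big_mkord xpredT (fun k => ((k%:Z < r)%R%:Z))).
rewrite (@big_cat_nat _ _ _ r) //= [X in _ + X]big_nat_cond [X in _ + X]big1 ?addr0.
  rewrite big_nat_cond (eq_bigr (fun=> 1)) => [|k /andP[/andP[_ kr] _]].
    by rewrite -big_nat_cond sumr_const_nat subn0 natz.
  by rewrite ltz_nat kr.
by move=> k /andP[/andP[rk _] _]; rewrite ltz_nat ltnNge rk.
Qed.

Lemma scaled_floor_err y : `|(scaled_floor y)%:~R / n%:R - y| <= n%:R^-1 :> R.
Proof.
have n0R : 0 < n%:R :> R by rewrite ltr0n.
have /andP[h1 h2] := floor_itv (n%:R * y).
rewrite -(ler_pM2r n0R) mulVf ?gt_eqF // -{2}(gtr0_norm n0R) -normrM mulrBl.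
rewrite mulfVK ?gt_eqF // [y * _]mulrC.
move: h1 h2; rewrite -/(scaled_floor y) intrD ler_norml; lra.
Qed.

Lemma dither_err k y : `|(dither k y)%:~R - y| <= 1 :> R.
Proof.
have n0R : 0 < n%:R :> R by rewrite ltr0n.
have /andP[h1 h2] := floor_itv (n%:R * y).
rewrite -(ler_pM2r n0R) mul1r -{1}(gtr0_norm n0R) -normrM mulrBl [y * _]mulrC.
move: h1 h2; rewrite -/(scaled_floor y) intrD => h1 h2.
rewrite /dither; set M := scaled_floor y in h1 h2 *.
set q := (M %/ n)%Z; set r := (M %% n)%Z.
(* Hence [n * y] lies between [q * n] and [(q + 1) * n], the two possible values of [n] times the
   dithered integer. *)
have rn : r + 1 <= n%:Z by rewrite lezD1; apply: ltz_pmod; rewrite ltz_nat.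
have r0 : 0 <= r by rewrite modz_ge0.
have Mq : M = q * n + r := divz_eq M n.
have MqR : M%:~R = q%:~R * n%:R + r%:~R :> R by rewrite {1}Mq intrD intrM.
have rnR : r%:~R + 1 <= n%:R :> R by rewrite -[n%:R]/(n%:Z%:~R) -(intrD _ r 1) ler_int.
have r0R : 0 <= r%:~R :> R by rewrite ler0z.
case: ltP => kr; rewrite intrD mulrDl ?mul1r ?mul0r ler_norml.
  have r1R : 1 <= r%:~R :> R.
    by rewrite -[1]/(1%:~R) ler_int -gtz0_ge1; apply: le_lt_trans kr.
  by lra.
lra.
Qed.

End Rounding.

Lemma unit_ball_sum (R : realType) (d : nat) (x : 'rV[R]_d) :
  unit_ball x -> \sum_(j < d) x ord0 j ^+ 2 <= 1.
Proof.
by rewrite /unit_ball /= -norm2_sqr => h; rewrite expr_le1 // sqrtr_ge0.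
Qed.

Section SampledQuantization.
Variables (R : realType) (d n : nat) (p : R).
Hypotheses (d_gt0 : (0 < d)%N) (n_gt0 : (0 < n)%N) (p_gt0 : 0 < p) (p_le1 : p <= 1).

Notation coin := (bool * 'I_n)%type.
Notation coins := {ffun 'I_n -> coin}.

(** The first component says whether the client speaks; the second is an independent uniform
    dither. *)
Definition coin_weight (b : coin) : R := (if b.1 then p else 1 - p) / n%:R.

Definition coins_weight (u : coins) : R := \prod_i coin_weight (u i).

Let sd : R := Num.sqrt d%:R.

(* One dither [k] serves all coordinates: only the expectation and the size of each
   coordinate matter. *)
Definition quantize (k : 'I_n) (x : 'rV[R]_d) : d.-tuple int :=
  [tuple dither k (sd * x ord0 j) | j < d].

(** The public coin decides on silence, so for a fixed seed the possible strings are either the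
    empty one alone or words of a prefix-free code. *)
Definition sampled_code (i : 'I_n) (u : coins) (x : 'rV[R]_d) : seq bool :=
  if (u i).1 then unary_seq (quantize (u i).2 x) else [::].

Definition unary_decode (m : seq bool) : d.-tuple int :=
  xget [tuple 0 | j < d] [set z : d.-tuple int | unary_seq z = m].

(** Division by [p] makes up for the silent clients and division by [sd] undoes the scaling, so the
    estimate is unbiased up to the rounding in [scaled_floor]. *)
Definition sampled_server (u : coins) (M : n.-tuple (seq bool)) : 'rV[R]_d :=
  \row_j (n%:R^-1 * \sum_i (if (u i).1
     then (tnth (unary_decode (tnth M i)) j)%:~R / (p * sd) else 0)).

Let n0 : 0 < n%:R :> R. Proof. by rewrite ltr0n. Qed.
Let d0 : 0 < d%:R :> R. Proof. by rewrite ltr0n. Qed.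
Let sd0 : 0 < sd. Proof. by rewrite sqrtr_gt0. Qed.
Let sd2 : sd ^+ 2 = d%:R. Proof. by rewrite sqr_sqrtr // ltW. Qed.

Lemma unary_seqK (z : d.-tuple int) : unary_decode (unary_seq z) = z.
Proof.
rewrite /unary_decode; case: xgetP => [t -> /= e|/(_ z) /(_ erefl) []].
by apply/val_inj/unary_seq_prefix_free; rewrite ?size_tuple // e prefix_refl.
Qed.

Lemma sampled_code_prefix_free i u x y :
  prefix (sampled_code i u x) (sampled_code i u y) ->
  sampled_code i u x = sampled_code i u y.
Proof.
rewrite /sampled_code; case: ifP => // _ /unary_seq_prefix_free -> //.
by rewrite !size_tuple.
Qed.

Lemma coin_weight_ge0 b : 0 <= coin_weight b.
Proof. by rewrite divr_ge0 //; case: b.1; [exact: ltW|rewrite subr_ge0]. Qed.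

Lemma sum_coin_weight_speak (F : 'I_n -> R) :
  \sum_b coin_weight b * (if b.1 then F b.2 else 0) = p / n%:R * \sum_k F k.
Proof.
rewrite -(pair_bigA _ (fun a k => coin_weight (a, k) * (if a then F k else 0))) /=.
rewrite big_bool /= mulr_sumr [X in _ + X]big1 ?addr0 // => k _.
by rewrite mulr0.
Qed.

Lemma sum_coin_weight : \sum_b coin_weight b = 1.
Proof.
rewrite -(pair_bigA _ (fun a k => coin_weight (a, k))) /= big_bool /=.
rewrite /coin_weight /= !sumr_const card_ord -mulrnDl -mulrDl addrC subrK mul1r.
by rewrite -(mulr_natr n%:R^-1) mulVf // gt_eqF.
Qed.

Lemma coins_weight_ge0 u : 0 <= coins_weight u.
Proof. by apply: prodr_ge0 => i _; exact: coin_weight_ge0. Qed.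

Lemma sum_coins_weight : \sum_u coins_weight u = 1.
Proof.
rewrite (sum_prod_ffun (fun (_ : 'I_n) => coin_weight)) big1 // => i _.
exact: sum_coin_weight.
Qed.

Lemma dither_norm_le (k : 'I_n) (y : R) : `|(dither k y)%:~R| <= `|y| + 1 :> R.
Proof.
rewrite -[_%:~R](subrK y) addrC.
by apply: le_trans (ler_normD _ _) _; rewrite lerD2l dither_err.
Qed.

Lemma size_quantize k (x : 'rV[R]_d) : unit_ball x ->
  (size (unary_seq (quantize k x)))%:R <= 4 * d%:R :> R.
Proof.
move=> /unit_ball_sum hx.
have -> : (size (unary_seq (quantize k x)))%:R =
    \sum_(j < d) (`|(dither k (sd * x ord0 j))%:~R| + 2) :> R.
  rewrite /unary_seq size_flatten /shape -map_comp sumnE big_map /= big_map big_enum /=.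
  rewrite natr_sum; apply: eq_bigr => j _.
  by rewrite size_rcons size_nseq -addn2 natrD -intr_norm -abszE.
(* Use [|y| <= (y ^+ 2 + 1) / 2]. The squares sum to at most [d], whence a total of
   [d / 2 + 7 * d / 2]. *)
apply: (@le_trans _ _ (\sum_(j < d) ((sd * x ord0 j) ^+ 2 / 2 + 7 / 2))).
  apply: ler_sum => j _; have := dither_norm_le k (sd * x ord0 j).
  set y := sd * _; have := sqr_ge0 (`|y| - 1); rewrite sqrrB1 real_normK ?num_real //.
  lra.
under eq_bigr do rewrite exprMn sd2.
rewrite big_split /= sumr_const card_ord -mulr_suml -mulr_sumr -(mulr_natr (7 / 2)).
have := ler_wpM2l (ltW d0) hx; lra.
Qed.

Lemma sampled_cost_le X : ball_data X ->
  \sum_u coins_weight u * \sum_i (size (sampled_code i u (X i)))%:R <=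
  4 * d%:R * n%:R * p.
Proof.
move=> hX; under eq_bigr do rewrite mulr_sumr.
rewrite exchange_big /=.
apply: (@le_trans _ _ (\sum_(i < n) 4 * d%:R * p)); last first.
  by rewrite sumr_const card_ord -mulr_natr; lra.
apply: ler_sum => i _.
pose h (b : coin) : R :=
  if b.1 then (size (unary_seq (quantize b.2 (X i))))%:R else 0.
rewrite (eq_bigr (fun u : coins => coins_weight u * h (u i))); last first.
  by move=> u _; rewrite /sampled_code /h; case: ifP.
rewrite (sum_prod_ffun1 (w := fun=> coin_weight) i h) => [|_]; last exact: sum_coin_weight.
rewrite (sum_coin_weight_speak (fun k => (size (unary_seq (quantize k (X i))))%:R)).
apply: (@le_trans _ _ (p / n%:R * \sum_(k < n) 4 * d%:R)).
  apply: ler_wpM2l; first by rewrite divr_ge0 // ltW.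
  by apply: ler_sum => k _; exact: size_quantize.
rewrite sumr_const card_ord -(mulr_natr (4 * d%:R)) le_eqVlt; apply/orP; left.
by apply/eqP; field; rewrite gt_eqF.
Qed.

(** In each coordinate [sum_prod_sqr_le] leaves second moments, of order [1 / p] because a term
    scaled by [1 / p] occurs with probability [p], and a squared bias. Over all coordinates these
    add up to at most [4 * n / p + 1 <= 5 * n / p], to be divided by [n ^+ 2]. *)
Lemma sampled_error_le X : ball_data X ->
  \sum_u coins_weight u *
    norm2 (sampled_server u [tuple sampled_code i u (X i) | i < n] - mean X) ^+ 2 <=
  5 / (n%:R * p).
Proof.
move=> hX.
pose F j i (b : coin) : R :=
  if b.1 then (dither b.2 (sd * X i ord0 j))%:~R / (p * sd) else 0.
pose a j := \sum_i X i ord0 j.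
have srv u j : (sampled_server u [tuple sampled_code i u (X i) | i < n] - mean X) ord0 j =
    n%:R^-1 * (\sum_i F j i (u i) - a j).
  rewrite mxE [X in _ + X]mxE mean_coord mxE mulrBr; congr (_ * _ - _); apply: eq_bigr => i _.
  rewrite tnth_mktuple /F /sampled_code; case: (u i) => [[] k] //=.
  by rewrite (unary_seqK (quantize k (X i))) tnth_mktuple.
under eq_bigr => u _.
  rewrite norm2_sqr mulr_sumr.
  under eq_bigr => j _ do rewrite srv exprMn mulrCA.
  over.
rewrite exchange_big /=; under eq_bigr do rewrite -mulr_sumr; rewrite -mulr_sumr.
have main j : \sum_(u : coins) coins_weight u * (\sum_i F j i (u i) - a j) ^+ 2 <=
    (\sum_i (2 * X i ord0 j ^+ 2 + 2 / d%:R)) / p + d%:R^-1.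
  apply: le_trans (sum_prod_sqr_le (fun i b => F j i b) (a j)
    (fun _ : 'I_n => coin_weight_ge0) (fun=> sum_coin_weight)) _.
  apply: lerD.
    rewrite mulr_suml; apply: ler_sum => i _.
    rewrite (eq_bigr (fun b : coin => coin_weight b * (if b.1 then
      ((dither b.2 (sd * X i ord0 j))%:~R / (p * sd)) ^+ 2 else 0))); last first.
      by move=> b _; rewrite /F; case: ifP => // _; rewrite expr0n.
    rewrite (sum_coin_weight_speak
      (fun k => ((dither k (sd * X i ord0 j))%:~R / (p * sd)) ^+ 2)).
    apply: (@le_trans _ _ (p / n%:R * \sum_(k < n)
       (2 * X i ord0 j ^+ 2 + 2 / d%:R) / p ^+ 2)).
      apply: ler_wpM2l; first by rewrite divr_ge0 // ltW.
      apply: ler_sum => k _; rewrite expr_div_n exprMn sd2.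
      set y := X i ord0 j; set z := (dither _ _)%:~R.
      have hz : z ^+ 2 <= 2 * (sd * y) ^+ 2 + 2.
        have h := dither_norm_le k (sd * y); rewrite -/z in h.
        rewrite -real_normK ?num_real // -[(sd * y) ^+ 2]real_normK ?num_real //.
        have : `|z| ^+ 2 <= (`|sd * y| + 1) ^+ 2 by rewrite ler_sqr ?nnegrE ?addr_ge0.
        have := sqr_ge0 (`|sd * y| - 1); rewrite sqrrB1 sqrrD1; lra.
      rewrite ler_pdivrMr ?mulr_gt0 ?exprn_gt0 //; apply: le_trans hz _.
      rewrite exprMn sd2 le_eqVlt; apply/orP; left; apply/eqP.
      by field; rewrite !gt_eqF.
    rewrite sumr_const card_ord -mulr_natr le_eqVlt; apply/orP; left; apply/eqP.
    by field; rewrite !gt_eqF.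
  have mF i : \sum_k coin_weight k * F j i k =
      (scaled_floor n (sd * X i ord0 j))%:~R / n%:R / sd.
    rewrite (sum_coin_weight_speak
      (fun k => (dither k (sd * X i ord0 j))%:~R / (p * sd))).
    by rewrite -mulr_suml sum_dither //; field; rewrite !gt_eqF.
  (* Each of the [n] clients contributes a bias of at most [1 / n] before the division by [sd]. *)
  have bias : `|\sum_i \sum_k coin_weight k * F j i k - a j| <= sd^-1.
    rewrite /a -sumrB; apply: le_trans (ler_norm_sum _ _ _) _.
    apply: (@le_trans _ _ (\sum_(i < n) n%:R^-1 / sd)); last first.
      by rewrite sumr_const card_ord -(mulr_natr (n%:R^-1 / sd)) mulrAC mulVf ?mul1r // gt_eqF.
    apply: ler_sum => i _; rewrite mF ler_pdivlMr // -[X in _ * X <= _](gtr0_norm sd0) -normrM.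
    rewrite mulrBl mulfVK ?gt_eqF // [X i ord0 j * _]mulrC.
    exact: scaled_floor_err.
  rewrite -real_normK ?num_real // -sd2 -exprVn ler_sqr ?nnegrE //.
  by rewrite invr_ge0 ltW.
have sq : \sum_(j < d) \sum_(i < n) (2 * X i ord0 j ^+ 2 + 2 / d%:R) <= 4 * n%:R.
  rewrite exchange_big /=; apply: (@le_trans _ _ (\sum_(i < n) 4)); last first.
    by rewrite sumr_const card_ord mulr_natr.
  apply: ler_sum => i _; rewrite big_split /= sumr_const card_ord -mulr_sumr.
  rewrite -(mulr_natr (2 / _)) mulfVK ?gt_eqF //.
  have := unit_ball_sum (hX i); lra.
apply: le_trans (ler_wpM2l _ (ler_sum _ (fun j _ => main j))) _.
  by rewrite exprn_ge0 // invr_ge0 ltW.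
rewrite big_split /= -mulr_suml sumr_const card_ord -(mulr_natr d%:R^-1) mulVf ?gt_eqF //.
apply: (@le_trans _ _ (n%:R^-1 ^+ 2 * (4 * n%:R / p + n%:R / p))).
  apply: ler_wpM2l; first by rewrite exprn_ge0 // invr_ge0 ltW.
  apply: lerD; first by rewrite ler_pM2r ?invr_gt0.
  by rewrite ler_pdivlMr // mul1r; apply: le_trans p_le1 _; rewrite ler1n.
rewrite le_eqVlt; apply/orP; left; apply/eqP.
by field; rewrite !gt_eqF.
Qed.

Lemma sampled_minimax_le :
  (minimax_error d n (4 * d%:R * n%:R * p) <= (5 / (n%:R * p))%:E)%E.
Proof.
apply: (@minimax_error_le R _ coins_weight [ffun=> (true, Ordinal n_gt0)]
  coins_weight_ge0 sum_coins_weight d n sampled_code sampled_code_prefix_free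
  sampled_server).
- exact: sampled_cost_le.
- exact: sampled_error_le.
Qed.

End SampledQuantization.

(** * Minimax bounds *)

(** In each coordinate the empirical variance is nonnegative, so the squared mean is at most the
    mean of the squares. *)
Lemma mean_ball (R : realType) (d n : nat) (X : 'I_n -> 'rV[R]_d) :
  (0 < n)%N -> ball_data X -> norm2 (mean X) ^+ 2 <= 1.
Proof.
move=> n_gt0 hX; have n0 : 0 < n%:R :> R by rewrite ltr0n.
rewrite norm2_sqr.
apply: (@le_trans _ _ (\sum_(j < d) n%:R^-1 * \sum_(i < n) X i ord0 j ^+ 2)).
  apply: ler_sum => j _; rewrite mean_coord exprMn.
  set m := n%:R^-1 * \sum_(i < n) X i ord0 j.
  have : 0 <= \sum_(i < n) (X i ord0 j - m) ^+ 2 by apply: sumr_ge0 => i _; exact: sqr_ge0.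
  have -> : \sum_(i < n) (X i ord0 j - m) ^+ 2 =
      \sum_(i < n) X i ord0 j ^+ 2 - n%:R * m ^+ 2.
    transitivity (\sum_(i < n) (X i ord0 j ^+ 2 - 2 * m * X i ord0 j + m ^+ 2)).
      by apply: eq_bigr => i _; ring.
    rewrite !big_split /= sumrN -mulr_sumr sumr_const card_ord -(mulr_natr (m ^+ 2)).
    have -> : \sum_(i < n) X i ord0 j = n%:R * m by rewrite /m mulVKf ?gt_eqF.
    ring.
  by rewrite subr_ge0 -exprMn -/m => h; rewrite ler_pdivlMl.
rewrite -mulr_sumr exchange_big /= ler_pdivrMl // mulr1.
apply: (@le_trans _ _ (\sum_(i < n) 1)); last by rewrite sumr_const card_ord.
by apply: ler_sum => i _; exact: unit_ball_sum (hX i).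
Qed.

Lemma silent_minimax_le (R : realType) (d n : nat) (c : R) :
  (0 < n)%N -> 0 <= c -> (minimax_error d n c <= 1%:E)%E.
Proof.
move=> n_gt0 c0.
apply: (@minimax_error_le R unit (fun=> 1) tt _ _ d n (fun _ _ _ => [::]) _
  (fun _ _ => 0)) => //.
- by rewrite sumr_const card_unit.
- by move=> X _; rewrite big1 // => u _; rewrite big1 ?mulr0.
- move=> X hX; rewrite (big_pred1 tt); last by case.
  rewrite mul1r sub0r norm2_sqr.
  under eq_bigr do rewrite mxE sqrrN.
  by rewrite -norm2_sqr; exact: mean_ball.
Qed.

Lemma minimax_error_upper (R : realType) (d n : nat) (c : R) :
  (0 < d)%N -> (0 < n)%N -> 0 < c -> c <= n%:R * d%:R ->
  (minimax_error d n c <= (20 * Num.min 1 (d%:R / c))%:E)%E.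
Proof.
move=> d_gt0 n_gt0 c0 cnd.
have n0 : 0 < n%:R :> R by rewrite ltr0n.
have d0 : 0 < d%:R :> R by rewrite ltr0n.
have [cd|dc] := leP 1 (d%:R / c).
  apply: le_trans (silent_minimax_le d n_gt0 (ltW c0)) _.
  by rewrite lee_fin; lra.
pose p := c / (4 * d%:R * n%:R).
have q0 : 0 < 4 * d%:R * n%:R :> R by rewrite !mulr_gt0.
have p0 : 0 < p by rewrite divr_gt0.
have p1 : p <= 1.
  rewrite ler_pdivrMr // mul1r; apply: le_trans cnd _.
  have := mulr_gt0 d0 n0; lra.
have := sampled_minimax_le d_gt0 n_gt0 p0 p1.
rewrite (_ : 4 * d%:R * n%:R * p = c); last by rewrite mulrC mulfVK ?gt_eqF.
rewrite (_ : 5 / (n%:R * p) = 20 * (d%:R / c)) //.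
by rewrite /p; field; rewrite !gt_eqF.
Qed.

Lemma minimax_error_lower (R : realType) (d n : nat) (c K : R) :
  (0 < d)%N -> (0 < n)%N -> 0 < c -> K = 8 * (16 * 16) ->
  K * c <= n%:R * d%:R -> K <= n%:R ->
  ((K^-1 * Num.min 1 (d%:R / c))%:E <= minimax_error d n c)%E.
Proof.
move=> d_gt0 n_gt0 c0 Kdef cnd nK.
have n0 : 0 < n%:R :> R by rewrite ltr0n.
have d0 : 0 < d%:R :> R by rewrite ltr0n.
have K0 : 0 < K by rewrite Kdef; lra.
set m := Num.min 1 (d%:R / c).
have m0 : 0 < m by rewrite lt_min ltr01 divr_gt0.
have m1 : m <= 1 by rewrite ge_min lexx.
have mc : m * c <= d%:R by rewrite -ler_pdivlMr // ge_min lexx orbT.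
(* [K <= n] serves when [m = 1], and [K * c <= n * d] when [m = d / c]. *)
have mn : K * n%:R^-1 <= m.
  rewrite ler_pdivrMr // /m; have [_|_] := leP 1 (d%:R / c); first by rewrite mul1r.
  by rewrite mulrAC ler_pdivlMr // [d%:R * _]mulrC.
(* With [D = delta ^+ 2 = m / 256], the losses [1 / n] and [64 * D ^+ 2 * c / d] are at most [D / 8]
   and [D / 4], so at least [D / 8 = m / K] remains of [D / 2]. *)
pose delta := Num.sqrt m / 16.
have delta_ge0 : 0 <= delta by rewrite divr_ge0 ?sqrtr_ge0.
have mD : m = 16 * (16 * delta ^+ 2).
  by rewrite /delta expr_div_n sqr_sqrtr ?ltW //; field.
have delta_le : delta <= 2^-1.
  by rewrite -ler_sqr ?nnegrE //; lra.
apply: le_ereal_inf_tmp => _ [pi hpi <-].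
apply: le_trans (cost_error_tradeoff n_gt0 d_gt0 delta_ge0 delta_le (ltW c0) hpi).
have -> : delta ^+ 4 = delta ^+ 2 * delta ^+ 2 by ring.
rewrite lee_fin; move: (delta ^+ 2) (sqr_ge0 delta) mD => D D0 mD.
have Dc : D * c / d%:R <= (16 * 16)^-1.
  rewrite ler_pdivrMr // ler_pdivlMl ?mulr_gt0 //.
  by rewrite (_ : _ * (D * c) = m * c) // mD; ring.
have -> : 64 * (D * D) / d%:R * c = 64 * (D * (D * c / d%:R)).
  by field; rewrite gt_eqF.
have h2 := ler_wpM2l D0 Dc.
have h1 : n%:R^-1 <= K^-1 * m by rewrite ler_pdivlMl.
have h3 : K^-1 * m = D / 8.
  by rewrite mD Kdef; field.
lra.
Qed.

Theorem theorem1 (R : realType) :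
  exists t a b : R, [/\ 0 < t < 1, 0 < a, 0 < b &
    forall (d n : nat) (c : R),
      0 < c -> c <= n%:R * d%:R * t -> t^-1 <= n%:R ->
      ((a * Num.min 1 (d%:R / c))%:E <= minimax_error d n c)%E /\
      (minimax_error d n c <= (b * Num.min 1 (d%:R / c))%:E)%E].
Proof.
have [K Kdef] : exists K : R, K = 8 * (16 * 16) by exists (8 * (16 * 16)).
have K0 : 0 < K by rewrite Kdef; lra.
have K1 : K^-1 < 1 by rewrite invf_lt1 // Kdef; lra.
exists K^-1, K^-1, 20; rewrite !invr_gt0; split; rewrite ?K0 // => d n c c0.
rewrite invrK ler_pdivlMr // [c * K]mulrC => cnd nK.
(* The positive cost [c] excludes [d = 0]. *)
have nd0 : 0 < n%:R * d%:R :> R by apply: lt_le_trans cnd; exact: mulr_gt0.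
have n_gt0 : (0 < n)%N by rewrite -(ltr0n R); exact: lt_le_trans nK.
have d_gt0 : (0 < d)%N.
  by rewrite lt0n; apply: contraTneq nd0 => ->; rewrite mulr0 ltxx.
split; first exact: minimax_error_lower.
apply: minimax_error_upper => //; apply: le_trans cnd.
by rewrite ler_peMl ?ltW // Kdef; lra.
Qed.
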